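(* Let $K$ be a post-critically finite self-similar set with a resistance form $\mathcal{E}$ coming from a regular self-similar harmonic structure, and let $K_\infty$ be an infinite blow-up of $K$ without boundary points, with the extended energy $\mathcal{E}_\infty$ and Laplacian $\Delta_\infty$ (written $\Delta$). Let $\nu$ be a non-negative Radon measure on $K_\infty$. Suppose $E\subset K_\infty$ is open and bounded, and let $u\in\operatorname{dom}_{\mathcal{M}}\Delta_\infty$. If $Lu=\Delta u-u\,\nu$ is a non-negative measure on $E$, then $$\max_{x\in E}u(x)\le \max_{p\in\partial E}u^{+}(p)$$ (that is, $u(x)\le\max_{p\in\partial E}u^+(p)$ for every $x\in E$). Moreover, if $u$ achieves a positive maximum over $E$ at an interior point $x\in E$, then $u$ is constant on the connected component of $E$ containing $x$.
   Context: **Fractal.** $K$ is the self-similar set of an iterated function system $\{F_1,\dots,F_N\}$ of injective contractions on a complete metric space. For a finite word $\omega=\omega_1\cdots\omega_n$ set $F_\omega=F_{\omega_1}\circ\cdots\circ F_{\omega_n}$ (identity for the empty word); $C_\omega=F_\omega(K)$ is called a cell. $K$ is post-critically finite: $V_0$ (the image in $K$ of the post-critical set) is a finite set, and $C_\omega\cap C_{\omega'}\subset F_\omega(V_0)\cap F_{\omega'}(V_0)$ for distinct words $\omega,\omega'$ of equal length. Put $V_{n+1}=\bigcup_iF_i(V_n)$ and $V_*=\bigcup_nV_n$, which is dense in $K$. **Energy.** There are an irreducible non-negative symmetric quadratic form $\mathcal{E}_0$ on functions on $V_0$, of the form $\mathcal{E}_0(u,u)=\sum_{p\neq q}c_{pq}(u(p)-u(q))^2$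 with $c_{pq}\ge0$ and connected graph $\{c_{pq}>0\}$, and factors $0<r_i<1$ such that, with $r_\omega=\prod_jr_{\omega_j}$ and $\mathcal{E}_n(u,u)=\sum_{|\omega|=n}r_\omega^{-1}\mathcal{E}_0(u\circ F_\omega,u\circ F_\omega)$, one has $\mathcal{E}_0(u,u)=\min\{\mathcal{E}_1(v,v):v|_{V_0}=u\}$ (regular harmonic structure). Then $\mathcal{E}_n(u,u)$ is non-decreasing in $n$, $\mathcal{E}(u,u)=\lim_n\mathcal{E}_n(u,u)$, and $\operatorname{dom}\mathcal{E}$ consists of the functions with finite limit. $(\mathcal{E},\operatorname{dom}\mathcal{E})$ is a resistance form. The resistance metric $R(p,q)=\sup\{|u(p)-u(q)|^2/\mathcal{E}(u,u):\mathcal{E}(u,u)>0\}$ on $V_*$ has completion homeomorphic to (and identified with) $K$, and functions in $\operatorname{dom}\mathcal{E}$ are continuous on $K$. **Blow-up.** Fix $\alpha\in\{1,\dots,N\}^{\mathbb{N}}$ that is not eventually constant. Let $\phi_n=F_{\alpha_1}^{-1}\circ\cdots\circ F_{\alpha_n}^{-1}$ and $K_n=\phi_n(K)$ (a copy of $K$ containing $K_{n-1}$ as the copy of the cell $F_{\alpha_n}(K)$ of $K$ when $K_n$ is rescaled to $K$ via the identification $\phi_n$ on words). More precisely, $\phi_n\circ F_{\alpha_n}\circ\cdots\circ F_{\alpha_1}$ is the identity on $K\subset K_n$. The infinite blow-up (without boundary points) is $K_\infty=\bigcup_nK_n$, with the topology in which a set is open iff its intersection with each $K_n$ is open in $K_n$.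 A set is bounded if it is contained in some $K_n$. The energy extends by $\mathcal{E}_\infty(u,u)=\lim_n r_{\alpha_1}\cdots r_{\alpha_n}\,\mathcal{E}(u\circ\phi_n,u\circ\phi_n)$ (a non-decreasing limit), with $\operatorname{dom}\mathcal{E}_\infty$ the functions on $K_\infty$ for which this is finite. **Laplacian.** $u\in\operatorname{dom}_{\mathcal{M}}\Delta_\infty$ with $\Delta_\infty u=\sigma$, $\sigma$ a finite signed Radon measure on $K_\infty$, means that $u\in\operatorname{dom}\mathcal{E}_\infty$ and $\mathcal{E}_\infty(u,v)=-\int v\,d\sigma$ for all compactly supported $v\in\operatorname{dom}\mathcal{E}_\infty$. **Notation.** $u^+(x)=\max\{u(x),0\}$; $u\,\nu$ is the measure with density $u$ with respect to $\nu$; $\partial E$ is the topological boundary of $E$ in $K_\infty$. ''Non-negative on $E$'' means that the measure of every Borel subset of $E$ is non-negative. *)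

(* Defs.v *)
From HB Require Import structures.
From mathcomp Require Import all_boot all_order all_algebra.
From mathcomp Require Import all_classical all_reals all_analysis.

Set Implicit Arguments.
Unset Strict Implicit.
Unset Printing Implicit Defensive.

Import Order.TTheory GRing.Theory Num.Theory.
Import numFieldNormedType.Exports.

Local Open Scope classical_set_scope.
Local Open Scope ring_scope.

(* The ambient space and the attractor K of an iterated function system.
   [attractor_nontrivial] excludes the degenerate case where all the maps have
   the same fixed point and K is a singleton. *)
Record self_similar (R : realType) := SelfSimilar {
  ambient : metricType R;
  ambient_complete : forall G : set_system ambient,
    ProperFilter G -> cauchy G -> exists x : ambient, G --> x;
  nmaps : nat;
  ifs : 'I_nmaps -> ambient -> ambient;
  ifs_injective : forall i, injective (ifs i);
  ifs_contraction : forall i, exists2 q : R, 0 <= q < 1 &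
    forall x y, mdist (ifs i x) (ifs i y) <= q * mdist x y;
  attractor : set ambient;
  attractor_compact : compact attractor;
  attractor_fixed : attractor = \bigcup_i (ifs i @` attractor);
  attractor_nontrivial :
    exists x y, [/\ attractor x, attractor y & x <> y]
}.

Arguments attractor {R} s.
Arguments attractor_compact {R} s.
Arguments attractor_fixed {R} s.

Section Fractal.
Context {R : realType} (S : self_similar R).

Local Notation N := (nmaps S).

(* K as a type, with the topology induced by the ambient space. *)
Definition fractal : Type := set_type (attractor S).

Lemma attractor_inhabited : exists x, attractor S x.
Proof. by have [x [y [Kx _ _]]] := attractor_nontrivial S; exists x. Qed.

HB.instance Definition _ := Topological.on fractal.
HB.instance Definition _ := isPointed.Build fractal
  (exist _ (sval (cid attractor_inhabited))
           (mem_set (svalP (cid attractor_inhabited)))).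

Lemma ifs_attractor (i : 'I_N) (x : fractal) : ifs i (\val x) \in attractor S.
Proof.
case: x => x /= /set_mem Kx; apply/mem_set; rewrite attractor_fixed.
by exists i => //; exists x.
Qed.

Definition Fmap (i : 'I_N) (x : fractal) : fractal :=
  exist _ (ifs i (\val x)) (ifs_attractor i x).

Definition Fword (w : seq 'I_N) (x : fractal) : fractal := foldr Fmap x w.

Definition cell (w : seq 'I_N) : set fractal := range (Fword w).

(* [address w x]: the coding map of the shift space sends w to x. *)
Definition address (w : nat -> 'I_N) (x : fractal) : Prop :=
  forall n, cell (mkseq w n) x.

Definition critical_set : set (nat -> 'I_N) :=
  [set w | exists x, address w x /\
    exists i j, [/\ i != j, cell [:: i] x & cell [:: j] x]].

Definition post_critical_set : set (nat -> 'I_N) :=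
  [set w | exists2 w', critical_set w' &
    exists m, forall k, w k = w' (m.+1 + k)%N].

Definition V0 : set fractal :=
  [set x | exists2 w, post_critical_set w & address w x].

Definition post_critically_finite : Prop :=
  finite_set V0 /\
  forall w w' : seq 'I_N, size w = size w' -> w != w' ->
    cell w `&` cell w' `<=` (Fword w @` V0) `&` (Fword w' @` V0).

Section Energy.
Variables (c : fractal -> fractal -> R) (r : 'I_N -> R).

Definition E0 (u v : fractal -> R) : R :=
  \sum_(p \in V0) \sum_(q \in V0) c p q * (u p - u q) * (v p - v q).

Definition rword (w : seq 'I_N) : R := \prod_(i <- w) r i.

Definition En (n : nat) (u v : fractal -> R) : R :=
  \sum_(w : n.-tuple 'I_N) (rword w)^-1 * E0 (u \o Fword w) (v \o Fword w).

(* Functions on the finite vertex sets V_0 and V_1 are given by arbitrary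
   functions on K, whose values elsewhere are irrelevant to E0 and En 1. *)
Definition regular_harmonic_structure : Prop :=
  [/\ [/\ forall p q, V0 p -> V0 q -> c p q = c q p,
          forall p q, V0 p -> V0 q -> p <> q -> 0 <= c p q &
          forall p q, V0 p -> V0 q -> exists s : seq fractal,
            path [rel x y | [&& x \in V0, y \in V0 & 0 < c x y]] p s
            /\ last p s = q],
      forall i, 0 < r i < 1 &
      forall u : fractal -> R,
        (exists2 v, {in V0, v =1 u} & En 1 v v = E0 u u) /\
        (forall v, {in V0, v =1 u} -> E0 u u <= En 1 v v)].

(* The energy form; its domain is realized directly on K, which is the
   completion of V_* in the resistance metric. *)
Definition domE : set (fractal -> R) :=
  [set u : fractal -> R | continuous u /\ cvgn (fun n => En n u u)].

Definition energy (u v : fractal -> R) : R := limn (fun n => En n u v).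

End Energy.

End Fractal.

(* Kigami's axioms (RF1)-(RF5). *)
Record resistance_form (R : realType) (T : Type) (dom : set (T -> R))
    (E : (T -> R) -> (T -> R) -> R) : Prop := ResistanceForm {
  rf_const : forall a : R, dom (fun=> a);
  rf_linear : forall (a : R) u v, dom u -> dom v ->
    dom (fun x => a * u x + v x);
  rf_sym : forall u v, dom u -> dom v -> E u v = E v u;
  rf_bilinear : forall (a : R) u v w, dom u -> dom v -> dom w ->
    E (fun x => a * u x + v x) w = a * E u w + E v w;
  rf_ge0 : forall u, dom u -> 0 <= E u u;
  rf_eq0 : forall u, dom u -> (E u u = 0 <-> exists a, u = fun=> a);
  rf_complete : forall u_ : nat -> T -> R, (forall n, dom (u_ n)) ->
    (forall e, 0 < e -> exists n0, forall m n, (n0 <= m)%N -> (n0 <= n)%N ->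
       E (u_ m \- u_ n) (u_ m \- u_ n) < e) ->
    exists2 u, dom u & (fun n => E (u_ n \- u) (u_ n \- u)) @ \oo --> (0 : R);
  rf_extend : forall (V : set T) (v : T -> R), finite_set V ->
    exists2 u, dom u & forall x, V x -> u x = v x;
  rf_metric : forall p q, exists M : R, forall u, dom u -> 0 < E u u ->
    `|u p - u q| ^+ 2 / E u u <= M;
  rf_markov : forall u, dom u ->
    let u1 := fun x => Num.min (Num.max (u x) 0) 1 in
    dom u1 /\ E u1 u1 <= E u u
}.

Section Blowup.
Context {R : realType} (S : self_similar R) (alpha : nat -> 'I_(nmaps S)).

(* [alpha k] is the letter alpha_{k+1}. [push n k] is the inclusion of K_n into
   K_{n+k} in coordinates, F_{alpha_{n+k}} o ... o F_{alpha_{n+1}}. *)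
Fixpoint push (n k : nat) (x : fractal S) : fractal S :=
  if k is k'.+1 then Fmap (alpha (n + k')) (push n k' x) else x.

Lemma pushD n k l x : push n (k + l) x = push (n + k) l (push n k x).
Proof.
by elim: l => [|l IH]; rewrite ?addn0 // addnS /= IH addnA.
Qed.

(* (n, x) stands for the point phi_n(x) of K_n. *)
Definition blowup_rel (a b : nat * fractal S) : bool :=
  `[< exists k l, (a.1 + k = b.1 + l)%N /\ push a.1 k a.2 = push b.1 l b.2 >].

Lemma blowup_rel_refl : reflexive blowup_rel.
Proof. by move=> a; apply/asboolP; exists 0%N, 0%N. Qed.

Lemma blowup_rel_sym : symmetric blowup_rel.
Proof.
by move=> a b; apply/asboolP/asboolP => -[k [l [e f]]]; exists l, k.
Qed.

Lemma blowup_rel_trans : transitive blowup_rel.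
Proof.
move=> b a d /asboolP[k [l [e f]]] /asboolP[k' [l' [e' f']]]; apply/asboolP.
exists (k + k')%N, (l' + l)%N; split; first by rewrite !addnA -e' e addnAC.
rewrite (pushD _ k k') f e -(pushD _ l k') addnC (pushD _ k' l) f' e'.
by rewrite -pushD.
Qed.

Canonical blowup_equiv :=
  EquivRel blowup_rel blowup_rel_refl blowup_rel_sym blowup_rel_trans.

(* The quotient of the disjoint union of copies of K (nat is discrete), i.e.
   the increasing union of the K_n with the final topology. *)
Definition blowup : Type :=
  quotient_topology {eq_quot blowup_equiv}%qT.

HB.instance Definition _ := Topological.on blowup.
Definition phi (n : nat) (x : fractal S) : blowup :=
  (\pi_({eq_quot blowup_equiv}) (n, x))%qT.

HB.instance Definition _ := isPointed.Build blowup (phi 0 point).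

Lemma phi_step n x : phi n.+1 (Fmap (alpha n) x) = phi n x.
Proof.
apply/eqmodP/asboolP; exists 0%N, 1%N.
by rewrite /= !addn0 addn1.
Qed.

Lemma push_inj n k : injective (push n k).
Proof.
elim: k => // k IH x y /= /(congr1 (@proj1_sig _ _)) /= e.
by apply: IH; apply: val_inj; exact: ifs_injective e.
Qed.

Lemma phi_inj n : injective (phi n).
Proof.
move=> x y /eqmodP/asboolP[k [l [/= /addnI <-]]].
exact: push_inj.
Qed.

Lemma phi_surj (z : blowup) : exists n x, z = phi n x.
Proof.
exists (repr z).1, (repr z).2; rewrite /phi -surjective_pairing.
by rewrite reprK.
Qed.

Lemma blowup_openP (U : set blowup) :
  open U <-> forall n, open (phi n @^-1` U).
Proof.
have -> : open U = open ((fun a => phi a.1 a.2) @^-1` U).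
  rewrite {1}/open /= /quotient_open; congr open.
  by apply/funext => -[n x].
split=> [oU n|oU].
  have cn : continuous (fun x : fractal S => (n, x)).
    move=> x W [[A B] /= [nA nB] ABW].
    apply: filterS nB => y By; apply: ABW; split => //=.
    exact: (nbhs_singleton nA).
  by apply: (@open_comp _ _ (fun x => (n, x)) _ _ oU) => x _; exact: cn.
rewrite openE => -[n x] /= Ux.
exists ([set n], phi n @^-1` U) => /=.
  split; first by rewrite /nbhs /= /principal_filter.
  by apply: open_nbhs_nbhs; split; [exact: oU|].
by move=> [m y] /= [-> ].
Qed.

Definition blowup_bounded (A : set blowup) : Prop :=
  exists n, A `<=` range (phi n).

Section BlowupEnergy.
Variables (c : fractal S -> fractal S -> R) (r : 'I_(nmaps S) -> R).

Definition energy_stage (u v : blowup -> R) (n : nat) : R :=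
  (\prod_(k < n) r (alpha k)) * energy c r (u \o phi n) (v \o phi n).

Definition domEinf : set (blowup -> R) :=
  [set u : blowup -> R | (forall n, domE c r (u \o phi n)) /\ cvgn (energy_stage u u)].

Definition energyinf (u v : blowup -> R) : R := limn (energy_stage u v).

End BlowupEnergy.

Definition borel_blowup : Type := g_sigma_algebraType (@open blowup).
HB.instance Definition _ := Measurable.on borel_blowup.

End Blowup.

Definition eventually_constant (T : Type) (a : nat -> T) : Prop :=
  exists n, forall m, (n <= m)%N -> a m = a n.

Definition boundary (T : topologicalType) (A : set T) : set T :=
  closure A `\` interior A.

Definition compactly_supported (R : realType) (T : topologicalType)
    (f : T -> R) : Prop :=
  compact (closure [set x | f x != 0]).

Definition radon (R : realType) (S : self_similar R)
    (alpha : nat -> 'I_(nmaps S))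
    (mu : {measure set (borel_blowup alpha) -> \bar R}) : Prop :=
  (forall C : set (blowup alpha), compact C -> (mu C < +oo)%E) /\
  (forall A : set (borel_blowup alpha), measurable A ->
     mu A = ereal_sup [set mu C | C in
       [set C : set (blowup alpha) | compact C /\ C `<=` A]]).

Section SignedMeasure.
Context d (T : measurableType d) (R : realType).
Variable sigma : {charge set T -> \bar R}.

Definition hahn_posset : set T := sval (cid (Hahn_decomposition sigma)).
Definition hahn_negset : set T :=
  sval (cid (svalP (cid (Hahn_decomposition sigma)))).
Definition hahnP : hahn_decomposition sigma hahn_posset hahn_negset :=
  svalP (cid (svalP (cid (Hahn_decomposition sigma)))).

Definition charge_integral (f : T -> R) : R :=
  \int[jordan_pos hahnP]_x f x - \int[jordan_neg hahnP]_x f x.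

End SignedMeasure.

Section Laplacian.
Context {R : realType} (S : self_similar R) (alpha : nat -> 'I_(nmaps S)).
Variables (c : fractal S -> fractal S -> R) (r : 'I_(nmaps S) -> R).

(* A charge is finite by definition; it is Radon when its total variation is. *)
Definition signed_radon (sigma : {charge set (borel_blowup alpha) -> \bar R}) :
  Prop := radon (charge_variation (hahnP sigma)).

(* u belongs to dom_M Delta_infty and Delta_infty u = sigma. *)
Definition is_laplacian (u : blowup alpha -> R)
    (sigma : {charge set (borel_blowup alpha) -> \bar R}) : Prop :=
  [/\ signed_radon sigma, domEinf c r u &
      forall v : blowup alpha -> R, domEinf c r v -> compactly_supported v ->
        energyinf c r u v = - charge_integral sigma v].

(* The set function sigma - u nu; it is meaningful on bounded Borel sets, where
   u nu is finite. *)
Definition schroedinger (sigma : {charge set (borel_blowup alpha) -> \bar R})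
    (nu : {measure set (borel_blowup alpha) -> \bar R}) (u : blowup alpha -> R)
    (B : set (borel_blowup alpha)) : \bar R :=
  (sigma B - \int[nu]_(x in B) (u x)%:E)%E.

End Laplacian.

Definition nonneg_on (R : realType) (d : measure_display)
    (T : measurableType d) (mu : set T -> \bar R) (A : set T) : Prop :=
  forall B : set T, measurable B -> B `<=` A -> (0 <= mu B)%E.

(* Main.v *)
(* Let E be contained in K_m. Test functions supported in E may be computed on the
   single copy K_m of K: a cell of K_n (n > m) outside K_m meets K_m in finitely many
   points, and K has no isolated point. Where u > 0 on E the charge Delta u is
   non-negative, so energy(u, v) <= 0 for all test functions v >= 0 supported there.
   If u exceeded M = max u^+ on the boundary, then v = (u - M - e)^+ 1_E would satisfy
   energy(v, v) <= energy(u, v) <= 0, hence be constant, hence zero. For the strong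
   principle, let M be the positive maximum of u over E: a logarithmic Caccioppoli
   estimate for h = M - u + e on a small cell bounds the energy of ln h independently
   of e; in a resistance form this controls the oscillation of ln h pointwise, so a zero
   of M - u propagates to the whole cell. Thus the set where the maximum is attained is
   open. *)

Require Import Defs.
From HB Require Import structures.
From mathcomp Require Import all_boot all_order all_algebra.
From mathcomp Require Import all_classical all_reals all_analysis.
From mathcomp Require Import finmap measurable_realfun ring lra.

Set Implicit Arguments.
Unset Strict Implicit.
Unset Printing Implicit Defensive.

Import Order.TTheory GRing.Theory Num.Theory.
Import numFieldNormedType.Exports.

Local Open Scope classical_set_scope.
Local Open Scope ring_scope.

(** * The topology of the fractal and of its cells *)

Section FractalTopology.
Context {R : realType} (S : self_similar R).

Lemma val_fractal_continuous : continuous (\val : fractal S -> ambient S).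
Proof. exact: initial_continuous. Qed.

Lemma nbhs_fractal (x : fractal S) (A : set (fractal S)) :
  nbhs x A -> exists2 O : set (ambient S), nbhs (\val x) O & \val @^-1` O `<=` A.
Proof.
case=> _ [[V oV <-] Vx] VA; exists V => //.
by apply: open_nbhs_nbhs; split.
Qed.

Lemma fractal_hausdorff : hausdorff_space (fractal S).
Proof.
move=> x y cxy; apply: val_inj; apply: (@metric_hausdorff R (ambient S)).
move=> A B nA nB.
have [z [Az Bz]] := cxy _ _ (val_fractal_continuous nA) (val_fractal_continuous nB).
by exists (\val z).
Qed.

Lemma fractal_compact : compact [set: fractal S].
Proof.
move=> F FF _.
have FK : ((\val : fractal S -> ambient S) @ F) (attractor S).
  by apply: (@filterE _ F); case=> x Kx; exact: set_mem Kx.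
have [y [Ky cy]] := @attractor_compact R S ((\val : fractal S -> ambient S) @ F) _ FK.
exists (exist _ y (mem_set Ky)); split => // A B FA /nbhs_fractal[V nO OB].
have FA' : ((\val : fractal S -> ambient S) @ F) (\val @` A).
  by apply: (@filterS _ F _ A) => // a Aa; exists a.
have [_ [[a Aa <-] Oa]] := cy _ _ FA' nO.
by exists a; split => //; exact: OB.
Qed.

Lemma closed_fractal_compact (A : set (fractal S)) : closed A -> compact A.
Proof. by move=> cA; exact: subclosed_compact cA fractal_compact _. Qed.

Lemma closed_image_fractal (f : fractal S -> fractal S) (A : set (fractal S)) :
  continuous f -> closed A -> closed (f @` A).
Proof.
move=> cf cA; apply: compact_closed; first exact: fractal_hausdorff.
apply: continuous_compact; last exact: closed_fractal_compact.
exact: continuous_subspaceT.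
Qed.

Lemma continuous_fractal (T : topologicalType) (f : T -> fractal S) :
  continuous (\val \o f : T -> ambient S) -> continuous f.
Proof.
move=> cf x A /nbhs_fractal[V nO OA].
by have := cf x _ nO; apply: (@filterS _ (nbhs x)) => y; exact: OA.
Qed.

Lemma Fmap_dist (i : 'I_(nmaps S)) : exists2 q : R, 0 <= q < 1 &
  forall x y : fractal S,
    mdist (\val (Fmap i x)) (\val (Fmap i y)) <= q * mdist (\val x) (\val y).
Proof.
by have [q q01 Hq] := ifs_contraction i; exists q => // x y; exact: Hq.
Qed.

Lemma Fmap_continuous (i : 'I_(nmaps S)) : continuous (@Fmap R S i).
Proof.
have [q /andP[q0 _] Hq] := Fmap_dist i.
apply: continuous_fractal => x A /nbhs_ballP[e /= e0 eA].
have : nbhs (\val x) (ball (\val x) (e / (q + 1))).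
  by apply: nbhsx_ballx; rewrite divr_gt0// ltr_wpDl.
move=> /val_fractal_continuous; apply: (@filterS _ (nbhs x)) => y /=.
rewrite ballEmdist /= => xy; apply: eA; rewrite ballEmdist /=.
apply: le_lt_trans (Hq _ _) _.
have q1 : 0 < q + 1 by rewrite ltr_wpDl.
rewrite ltr_pdivlMr// in xy; apply: le_lt_trans xy.
by rewrite mulrC ler_wpM2l ?mdist_ge0// lerDl.
Qed.

Lemma Fmap_inj (i : 'I_(nmaps S)) : injective (@Fmap R S i).
Proof.
move=> x y /(congr1 \val) /= e; apply: val_inj; exact: ifs_injective e.
Qed.

Lemma Fword_continuous (w : seq 'I_(nmaps S)) : continuous (@Fword R S w).
Proof.
elim: w => [|i w IH] x; first exact: cvg_id.
exact: continuous_comp (IH _) (@Fmap_continuous _ _).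
Qed.

Lemma Fword_inj (w : seq 'I_(nmaps S)) : injective (@Fword R S w).
Proof. by elim: w => [//|i w IH] x y /= /Fmap_inj/IH. Qed.

Lemma Fmap_cover (x : fractal S) : exists i y, x = Fmap i y.
Proof.
case: x => x xK.
have : (\bigcup_i (ifs i @` attractor S)) x.
  by rewrite -attractor_fixed; exact: set_mem.
move=> [i _ [y Ky e]].
by exists i, (exist _ y (mem_set Ky)); apply: val_inj.
Qed.

Lemma cell_cover (n : nat) (x : fractal S) : exists2 w, size w = n & cell w x.
Proof.
elim: n x => [|n IH] x; first by exists [::] => //; exists x.
have [i [y ->]] := Fmap_cover x.
have [w sw [z _ <-]] := IH y.
by exists (i :: w) => /=; [rewrite sw|exists z].
Qed.

Lemma fractal_bounded : exists2 D : R, 0 < D &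
  forall x y : fractal S, mdist (\val x) (\val y) <= D.
Proof.
pose p : ambient S := \val (point : fractal S).
have /compact_near_coveringP := @fractal_compact.
(* Near-covering form of compactness: a bound on the distance to [p] that holds near each point
   becomes one bound for all points. *)
move=> /(_ _ (+oo : set_system R) (fun D x => mdist p (\val x) <= D) _) [].
  move=> x _.
  exists (\val @^-1` (ball (\val x) 1), [set D | mdist p (\val x) + 1 <= D]) => /=.
    split; last by apply: nbhs_pinfty_ge; exact: num_real.
    by apply: val_fractal_continuous; apply: nbhsx_ballx.
  move=> [x' D] /= [+ HD]; rewrite ballEmdist /= => xx'.
  apply: le_trans (metric_triangle _ (\val x) _) _.
  by apply: le_trans HD; rewrite lerD2l ltW.
move=> M [_ HM].
pose D := Num.max M 0 + 1.
have D0 : 0 < D by rewrite ltr_wpDl// le_max lexx orbT.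
have HD (x : fractal S) : mdist p (\val x) <= D.
  by apply: (HM D) => //; rewrite (le_lt_trans (y := Num.max M 0))// ?le_max ?lexx// ltrDl.
exists (D + D); first by rewrite addr_gt0.
move=> x y; apply: le_trans (metric_triangle _ p _) _.
by rewrite metric_sym lerD.
Qed.

(* The finitely many maps contract at a common rate. *)
Lemma cell_dist (e : R) : 0 < e -> exists n0, forall n w (x y : fractal S),
  (n0 <= n)%N -> size w = n -> cell w x -> cell w y ->
  mdist (\val x) (\val y) < e.
Proof.
move=> e0; have [D D0 HD] := fractal_bounded.
pose q i : R := sval (cid2 (@Fmap_dist i)).
have q01 i : 0 <= q i < 1 by exact: (s2valP (cid2 (@Fmap_dist i))).
pose Q : R := \big[Num.max/0]_i q i.
have Q0 : 0 <= Q by exact: bigmax_ge_id.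
have Q1 : Q < 1 by apply/bigmax_ltP; split => // i _; have /andP[] := q01 i.
have HQ i (x y : fractal S) :
    mdist (\val (Fmap i x)) (\val (Fmap i y)) <= Q * mdist (\val x) (\val y).
  apply: le_trans (s2valP' (cid2 (@Fmap_dist i)) x y) _.
  by rewrite ler_wpM2r ?mdist_ge0//; exact: (le_bigmax _ q i).
have HW w (x y : fractal S) :
    mdist (\val (Fword w x)) (\val (Fword w y)) <= Q ^+ size w * D.
  elim: w => [|i w IH]; first by rewrite expr0 mul1r; exact: HD.
  by apply: le_trans (HQ _ _ _) _; rewrite exprS -mulrA ler_wpM2l.
have : (fun n => Q ^+ n * D) @ \oo --> 0 * D.
  by apply: cvgM; [apply: cvg_expr|exact: cvg_cst]; rewrite ger0_norm.
rewrite mul0r => /cvgr0Pnorm_lt /(_ e e0) [n0 _ Hn0].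
exists n0 => n w x y n0n sw [x' _ <-] [y' _ <-].
apply: le_lt_trans (HW _ _ _) _; rewrite sw.
by apply: le_lt_trans (ler_norm _) _; exact: Hn0.
Qed.

(** A Lebesgue number argument: the compact set [F] has positive distance to the complement of [G],
    and the diameters of cells tend to zero uniformly in the length of the word. *)
Lemma small_cells (F G : set (fractal S)) : closed F -> open G -> F `<=` G ->
  exists n0, forall n w, (n0 <= n)%N -> size w = n ->
    (exists2 x, F x & cell w x) -> cell w `<=` G.
Proof.
move=> cF oG FG.
have /compact_near_coveringP/near_covering_withinP := closed_fractal_compact cF.
move=> /(_ _ (0 : R)^'+ (fun d x => forall y : fractal S,
  mdist (\val x) (\val y) < d -> G y) _) [].
  move=> x Fx; have := oG; rewrite openE => /(_ _ (FG _ Fx)).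
  move=> /nbhs_fractal[V]; rewrite -nbhs_ballE => -[d /= d0 dO] OG.
  (* Half the radius goes to moving the centre and half to the new distance, so one radius serves a
     whole neighbourhood of [x]. *)
  exists (\val @^-1` (ball (\val x) (d / 2)), [set t | t < d / 2]) => /=.
    split; last by apply: nbhs_right_lt; rewrite divr_gt0.
    by apply: val_fractal_continuous; apply: nbhsx_ballx; rewrite divr_gt0.
  move=> [x' t] /= [xx' td] _ y x'y; apply: OG; apply: dO.
  rewrite ballEmdist /= in xx' *; rewrite ballEmdist /=.
  apply: le_lt_trans (metric_triangle _ (\val x') _) _.
  by rewrite (splitr d) ltrD// (lt_trans x'y).
move=> d /= d0 Hd.
have dd : 0 < d / 2 by rewrite divr_gt0.
have [n0 Hn0] := cell_dist dd.
exists n0 => n w n0n sw [x Fx wx] y wy.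
apply: (Hd (d / 2)) dd _ Fx _ _; last exact: (Hn0 n w).
by rewrite /ball_ /= sub0r normrN gtr0_norm ?divr_gt0// ltr_pdivrMr// ltr_pMr// ltr1n.
Qed.

(** If the map were onto, iterating it would give $K$ diameter at most $q^n D$ for every $n$, so $K$
    would be a single point. This makes each copy in the blow-up strictly larger than the preceding
    one. *)
Lemma Fmap_not_surj (i : 'I_(nmaps S)) : exists x, ~ range (@Fmap R S i) x.
Proof.
apply/existsNP => Fi.
have [q /andP[q0 q1] Hq] := Fmap_dist i.
have [D D0 HD] := fractal_bounded.
have HDn n (x y : fractal S) : mdist (\val x) (\val y) <= q ^+ n * D.
  elim: n x y => [|n IH] x y; first by rewrite expr0 mul1r.
  have [[x' _ <-] [y' _ <-]] := (Fi x, Fi y).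
  by apply: le_trans (Hq _ _) _; rewrite exprS -mulrA ler_wpM2l.
have qD : (fun n => q ^+ n * D) @ \oo --> 0 * D.
  by apply: cvgM; [apply: cvg_expr|exact: cvg_cst]; rewrite ger0_norm.
have [x [y [Kx Ky xy]]] := attractor_nontrivial S.
apply: xy; apply: mdist_positivity; apply/eqP.
rewrite eq_le mdist_ge0 andbT -(mul0r D) -(cvg_lim _ qD)//.
apply: limr_ge; first by apply/cvg_ex; exists (0 * D).
near=> n; exact: (HDn n (exist _ x (mem_set Kx)) (exist _ y (mem_set Ky))).
Unshelve. all: by end_near. Qed.

(** If the singleton were open, it would contain a whole small cell; but a cell is an injective
    image of $K$, which has two distinct points. *)
Lemma not_isolated (x : fractal S) : ~ open [set x].
Proof.
move=> ox.
have cx : closed [set x].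
  by apply: accessible_closed_set1; apply/hausdorff_accessible/fractal_hausdorff.
have [n0 Hn0] := small_cells cx ox (@subset_refl _ _).
have [w sw wx] := cell_cover n0 x.
have wsub : cell w `<=` [set x] by apply: (Hn0 n0) => //; exists x.
have [a [b [Ka Kb ab]]] := attractor_nontrivial S; apply: ab.
pose a' : fractal S := exist _ a (mem_set Ka).
pose b' : fractal S := exist _ b (mem_set Kb).
have : Fword w a' = Fword w b'.
  have Hw z : Fword w z = x by apply: wsub; exists z.
  by rewrite (Hw a') (Hw b').
by move=> /Fword_inj [].
Qed.

Lemma open_finite_set0 (U : set (fractal S)) :
  open U -> finite_set U -> U = set0.
Proof.
move=> oU fU; apply/seteqP; split => // x Ux.
apply: (@not_isolated x).
have -> : [set x] = U `&` ~` (U `\ x).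
  apply/seteqP; split => [_ ->|y [Uy nUy]]; first by split => // -[_]; exact.
  by apply: contrapT => yx; apply: nUy.
apply: openI => //; apply: closed_openC.
have /accessible_finite_set_closed : accessible_space (fractal S).
  exact/hausdorff_accessible/fractal_hausdorff.
by apply; apply: sub_finite_set fU => y [].
Qed.

End FractalTopology.

(** * The discrete energies *)

Section KernelForm.
Context {R : realType} (S : self_similar R).
Context (c : fractal S -> fractal S -> R) (r : 'I_(nmaps S) -> R).
Context (Spcf : post_critically_finite S) (Hharm : regular_harmonic_structure c r).

Let W0P p : (p \in fset_set (@V0 R S)) = (p \in @V0 R S).
Proof. by rewrite in_fset_set//; have [] := Spcf. Qed.

(* En for an arbitrary kernel P, so that combinations of energies can be compared
   pair by pair inside small cells. The factor [p != q] removes the diagonal, where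
   the sign of c is not prescribed. *)
Definition kform (n : nat) (P : fractal S -> fractal S -> R) : R :=
  \sum_(w : n.-tuple 'I_(nmaps S)) (rword r w)^-1 *
    \sum_(p <- fset_set (@V0 R S)) \sum_(q <- fset_set (@V0 R S))
      (p != q)%:R * c p q * P (Fword w p) (Fword w q).

Definition dkernel (u v : fractal S -> R) (x y : fractal S) : R :=
  (u x - u y) * (v x - v y).

Definition same_cell (n : nat) (x y : fractal S) : Prop :=
  exists2 w, size w = n & cell w x /\ cell w y.

Lemma En_kform n u v : En c r n u v = kform n (dkernel u v).
Proof.
have [Vfin _] := Spcf.
apply: eq_bigr => w _; congr (_ * _).
rewrite /E0 fsbig_finite//=; apply: eq_bigr => p _.
rewrite fsbig_finite//=; apply: eq_bigr => q _.
by have [->|_] := eqVneq p q; rewrite ?subrr ?(mul0r, mulr0, mul1r, mulrA).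
Qed.

Lemma kformD n P Q :
  kform n (fun x y => P x y + Q x y) = kform n P + kform n Q.
Proof.
rewrite /kform -big_split /=; apply: eq_bigr => w _; rewrite -mulrDr.
congr (_ * _); rewrite -big_split /=; apply: eq_bigr => p _.
by rewrite -big_split /=; apply: eq_bigr => q _; rewrite mulrDr.
Qed.

Lemma kformZ n a P : kform n (fun x y => a * P x y) = a * kform n P.
Proof.
rewrite /kform mulr_sumr; apply: eq_bigr => w _; rewrite mulrCA.
congr (_ * _); rewrite mulr_sumr; apply: eq_bigr => p _.
by rewrite mulr_sumr; apply: eq_bigr => q _; rewrite mulrCA.
Qed.

Lemma kformS n P : kform n.+1 P =
  \sum_i (r i)^-1 * kform n (fun x y => P (Fmap i x) (Fmap i y)).
Proof.
rewrite {1}/kform.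
(* A word of length [n.+1] is a first letter followed by a word of length [n]. *)
rewrite (reindex (fun p : 'I_(nmaps S) * n.-tuple 'I_(nmaps S) =>
  [tuple of p.1 :: p.2])) /=; last first.
  exists (fun t => (thead t, [tuple of behead t])) => [[i w] _|t _] /=.
    by congr pair; apply: val_inj.
  by rewrite -tuple_eta.
rewrite -(pair_bigA _ (fun i (w : n.-tuple 'I_(nmaps S)) => (rword r (i :: w))^-1 *
    \sum_(p <- fset_set (@V0 R S)) \sum_(q <- fset_set (@V0 R S))
      (p != q)%:R * c p q * P (Fword (i :: w) p) (Fword (i :: w) q))) /=.
apply: eq_bigr => i _; rewrite mulr_sumr; apply: eq_bigr => w _.
by rewrite /rword big_cons invfM mulrA.
Qed.

Lemma r_gt0 i : 0 < r i.
Proof. by have [_ /(_ i)/andP[]] := Hharm. Qed.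

Lemma rword_gt0 w : 0 < rword r w.
Proof. by apply: prodr_gt0 => i _; exact: r_gt0. Qed.

Lemma le_kform n P Q : (forall x y, same_cell n x y -> P x y <= Q x y) ->
  kform n P <= kform n Q.
Proof.
move=> PQ; have [[_ c0 _] _ _] := Hharm.
apply: ler_sum => w _; rewrite ler_pM2l ?invr_gt0 ?rword_gt0//.
rewrite big_seq [leRHS]big_seq; apply: ler_sum => p; rewrite W0P => /set_mem Vp.
rewrite big_seq [leRHS]big_seq; apply: ler_sum => q; rewrite W0P => /set_mem Vq.
have [->|/eqP pq] := eqVneq p q; first by rewrite /= !mul0r.
rewrite /= !mul1r ler_wpM2l ?c0//; apply: PQ.
by exists w; rewrite ?size_tuple//; split; [exists p|exists q].
Qed.

Lemma kform_ge0 n P : (forall x y, same_cell n x y -> 0 <= P x y) ->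
  0 <= kform n P.
Proof.
move=> P0; have <- : kform n (fun x y => 0 * P x y) = 0 by rewrite kformZ mul0r.
by apply: le_kform => x y xy; rewrite mul0r P0.
Qed.

Lemma eq_kform n P Q : (forall x y, same_cell n x y -> P x y = Q x y) ->
  kform n P = kform n Q.
Proof.
by move=> PQ; apply/eqP; rewrite eq_le !le_kform// => x y /PQ ->.
Qed.

Lemma same_cell_Fmap n i x y :
  same_cell n x y -> same_cell n.+1 (Fmap i x) (Fmap i y).
Proof.
move=> [w sw [[x' _ <-] [y' _ <-]]].
by exists (i :: w); rewrite /= ?sw//; split; [exists x'|exists y'].
Qed.

(** The left side collects exactly the terms of words with prefix [w]; the terms dropped from the
    right side are non-negative. *)
Lemma kform_cell w n P :
  (forall x y, same_cell (size w + n) x y -> 0 <= P x y) ->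
  (rword r w)^-1 * kform n (fun x y => P (Fword w x) (Fword w y)) <=
  kform (size w + n) P.
Proof.
elim: w P => [|i w IH] P P0; first by rewrite /rword big_nil invr1 mul1r.
rewrite addSn kformS (bigD1 i)//= -[leLHS]addr0 lerD//.
  rewrite /rword big_cons invfM -mulrA ler_pM2l ?invr_gt0 ?r_gt0//.
  by apply: IH => x y xy; apply: P0; exact: same_cell_Fmap.
apply: sumr_ge0 => j _; rewrite mulr_ge0 ?invr_ge0 ?(ltW (r_gt0 j))//.
by apply: kform_ge0 => x y xy; apply: P0; exact: same_cell_Fmap.
Qed.

(** The step from level 0 to 1 is the minimality in the harmonic structure, with [u] as its own
    competitor; self-similarity carries it to higher levels. *)
Lemma En_nondecreasing u : nondecreasing_seq (fun n => En c r n u u).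
Proof.
apply/nondecreasing_seqP => n; elim: n u => [|n IH] u.
  rewrite [leLHS]/En (big_pred1 [tuple]) => [|w]; last by rewrite /= tuple0; apply/esym/eqP.
  rewrite /rword big_nil invr1 mul1r.
  by have [_ _ /(_ u)[_]] := Hharm; exact.
rewrite !En_kform !kformS; apply: ler_sum => i _.
rewrite ler_pM2l ?invr_gt0 ?r_gt0//.
by have := IH (u \o Fmap i); rewrite !En_kform.
Qed.

Lemma En_cell w n u :
  (rword r w)^-1 * En c r n (u \o Fword w) (u \o Fword w) <=
  En c r (size w + n) u u.
Proof.
rewrite !En_kform; apply: (@kform_cell w n (dkernel u u)) => x y _.
exact: sqr_ge0.
Qed.

End KernelForm.

(** * The energy form and its domain *)

Section EnergyDomain.
Context {R : realType} (S : self_similar R).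
Context (c : fractal S -> fractal S -> R) (r : 'I_(nmaps S) -> R).
Context (Spcf : post_critically_finite S) (Hharm : regular_harmonic_structure c r).
Context (Hres : resistance_form (domE c r) (energy c r)).

Local Notation dom := (domE c r).
Local Notation En := (En c r).
Local Notation energy := (energy c r).

Lemma domE_bounded (v : fractal S -> R) (B : R) : continuous v ->
  (\forall n \near \oo, En n v v <= B) -> dom v.
Proof.
move=> cv [N _ HB]; split => //; apply: nondecreasing_is_cvgn.
  exact: En_nondecreasing.
exists B => _ [n _ <-]; apply: le_trans (HB (maxn n N) (leq_maxr _ _)).
by apply: (En_nondecreasing Spcf Hharm); exact: leq_maxl.
Qed.

Lemma En_le_energy n u : dom u -> En n u u <= energy u u.
Proof.
move=> [_ cu]; apply: (nondecreasing_cvgn_le _ cu).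
exact: En_nondecreasing.
Qed.

Lemma domE_cvg u v : dom u -> dom v ->
  (fun n => En n u v) @ \oo --> energy u v.
Proof.
move=> du dv.
have du' : dom (fun x => -1 * u x + v x) by apply: (rf_linear Hres).
have dv' : dom (fun x => 1 * u x + v x) by apply: (rf_linear Hres).
suff : cvgn (fun n => En n u v) by [].
(* Polarization: $4E_n(u,v)=E_n(u+v,u+v)-E_n(v-u,v-u)$, where both diagonal terms converge by the
   definition of the domain. *)
have -> : (fun n => En n u v) = (fun n =>
    4^-1 * (En n (fun x => 1 * u x + v x) (fun x => 1 * u x + v x) +
      - En n (fun x => -1 * u x + v x) (fun x => -1 * u x + v x))).
  apply/funext => n; rewrite !En_kform//.
  rewrite -[X in _ * (_ + X)]mulN1r -kformZ -kformD -kformZ; apply: eq_kform => // x y _.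
  rewrite /dkernel.
  lra.
apply: is_cvgM; first exact: is_cvg_cst.
apply: is_cvgB; first by have [] := dv'.
by have [] := du'.
Qed.

(** Energies are limits, so the integrands need to be compared only for pairs in a common cell of
    fine scale; this makes all energy estimates below local. *)
Lemma le_energy f g v w : dom f -> dom g -> dom v -> dom w ->
  (\forall n \near \oo, forall x y, same_cell n x y ->
     dkernel f g x y <= dkernel v w x y) ->
  energy f g <= energy v w.
Proof.
move=> df dg dv dw H.
apply: ler_cvg_to (domE_cvg df dg) (domE_cvg dv dw) _.
by apply: filterS H => n H; rewrite !En_kform//; exact: le_kform.
Qed.

(** The cell of [w] carries at most the whole energy of [u]; rescaling by [rword r w] gives the
    bound. *)
Lemma domE_Fword w u : dom u -> dom (u \o Fword w).
Proof.
move=> du; have [cu _] := du.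
apply: (@domE_bounded _ (rword r w * energy u u)).
  by move=> x; apply: continuous_comp (@Fword_continuous _ _ w x) (cu _).
apply: nearW => n; rewrite -ler_pdivrMl ?(rword_gt0 Hharm)//.
exact: le_trans (En_cell Spcf Hharm w n u) (En_le_energy _ du).
Qed.

(** A fine cell either meets [F], and then lies in [G], or misses [F] altogether. Functions
    supported in [F] can thus be handled by formulas valid only on [G]. *)
Lemma same_cell_small (F G : set (fractal S)) : closed F -> open G -> F `<=` G ->
  \forall n \near \oo, forall x y, same_cell n x y ->
    (G x /\ G y) \/ (~ F x /\ ~ F y).
Proof.
move=> cF oG FG; have [n0 Hn0] := small_cells cF oG FG.
exists n0 => // n /= n0n x y [w sw [wx wy]].
have [[z Fz wz]|nF] := pselect (exists2 z, F z & cell w z).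
  have wG : cell w `<=` G by apply: (Hn0 n) => //; exists z.
  by left; split; exact: wG.
by right; split => Fz; apply: nF; [exists x|exists y].
Qed.

(** Membership test for functions defined by a formula on [G] and by zero elsewhere: fine cells
    inside [G] are controlled by the energies of [f] and [g], and all others contribute nothing. *)
Lemma domE_local (F G : set (fractal S)) (C : R) (f g v : fractal S -> R) :
  closed F -> open G -> F `<=` G -> dom f -> dom g -> 0 <= C ->
  continuous v -> (forall x, ~ F x -> v x = 0) ->
  (forall x y, G x -> G y ->
     (v x - v y) ^+ 2 <= C * ((f x - f y) ^+ 2 + (g x - g y) ^+ 2)) ->
  dom v.
Proof.
move=> cF oG FG df dg C0 cv v0 Hv.
apply: (@domE_bounded _ (C * (energy f f + energy g g))) => //.
have := same_cell_small cF oG FG; apply: filterS => n Hn.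
apply: (@le_trans _ _ (C * (En n f f + En n g g))); last first.
  by rewrite ler_wpM2l// lerD// En_le_energy.
rewrite !En_kform// -kformD -kformZ; apply: le_kform => // x y /Hn.
rewrite /dkernel -!expr2 => -[[Gx Gy]|[Fx Fy]]; first exact: Hv.
by rewrite !v0// subrr expr0n /= mulr_ge0// addr_ge0// sqr_ge0.
Qed.

(* The indicator function of G is constant on small cells, so its energy vanishes. *)
Lemma clopen_fractal (G : set (fractal S)) : open G -> closed G ->
  G !=set0 -> G = setT.
Proof.
move=> oG cG [x Gx].
pose v : fractal S -> R := fun y => (y \in G)%:R.
have v1 y : G y -> v y = 1 by move=> Gy; rewrite /v mem_set.
have v0 y : ~ G y -> v y = 0 by move=> Gy; rewrite /v memNset.
have d0 : dom (fun=> 0) by apply: (rf_const Hres).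
have cv : continuous v.
  move=> y A /nbhs_singleton Avy; have [Gy|nGy] := pselect (G y).
    have := oG; rewrite openE => /(_ _ Gy); apply: (@filterS _ (nbhs y)) => z Gz.
    by rewrite /= v1// -(v1 y).
  have := closed_openC cG; rewrite openE => /(_ _ nGy).
  by apply: (@filterS _ (nbhs y)) => z Gz; rewrite /= v0// -(v0 y).
have dv : dom v.
  apply: (@domE_local G G 0 _ _ v cG oG _ d0 d0) => // y z Gy Gz.
  by rewrite !v1// subrr mul0r expr0n.
have E0 : energy v v = 0.
  apply/eqP; rewrite eq_le (rf_ge0 Hres)// andbT.
  have e0 : energy (fun=> 0) (fun=> 0) = 0.
    by apply/(rf_eq0 Hres d0); exists 0.
  rewrite -e0; apply: le_energy => //.
  have := same_cell_small cG oG (@subset_refl _ _); apply: filterS => n Hn y z.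
  rewrite /dkernel subrr mul0r => /Hn[[Gy Gz]|[Gy Gz]].
    by rewrite !v1// subrr mul0r.
  by rewrite !v0// subrr mul0r.
have [a va] := (rf_eq0 Hres dv).1 E0.
apply/seteqP; split => // y _; apply: contrapT => /v0.
move: (v1 _ Gx); rewrite va => -> /eqP; by rewrite oner_eq0.
Qed.

End EnergyDomain.

(** * Maximum principles on the fractal *)

Section RealInequalities.
Context {R : realType}.
Implicit Types a b e f g : R.

Lemma ln_sub_le a b : 0 < a -> 0 < b -> ln a - ln b <= (a - b) / b.
Proof.
move=> a0 b0; rewrite -ln_div ?posrE//.
have -> : a / b = 1 + (a - b) / b by field; rewrite gt_eqF.
by apply: le_ln1Dx; rewrite ltr_pdivlMr// mulN1r; lra.
Qed.

(** With $x=\sqrt a\ge y=\sqrt b$, the bound $y(\ln x-\ln y)\le x-y$ is multiplied by $x\le x+y$;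
    the factor 4 comes from $\ln a=2\ln x$ and is not sharp. *)
Lemma ln_sub_sqr a b : 0 < a -> 0 < b ->
  a * b * (ln a - ln b) ^+ 2 <= 4 * (a - b) ^+ 2.
Proof.
wlog ba : a b / b <= a.
  move=> H a0 b0; have [ba|/ltW ab] := leP b a; first exact: H.
  have := H b a ab b0 a0.
  by rewrite mulrC [b * a]mulrC mulrC -(sqrrN (ln b - _)) -(sqrrN (b - a)) !opprB.
move=> a0 b0.
pose x : R := Num.sqrt a; pose y : R := Num.sqrt b.
have x0 : 0 < x by rewrite sqrtr_gt0.
have y0 : 0 < y by rewrite sqrtr_gt0.
have yx : y <= x by apply: ler_wsqrtr.
have -> : a = x ^+ 2 by rewrite sqr_sqrtr ?ltW.
have -> : b = y ^+ 2 by rewrite sqr_sqrtr ?ltW.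
rewrite !lnXn// !mulr2n.
have H1 : 0 <= ln x - ln y by rewrite subr_ge0 ler_ln ?posrE.
have H2 : y * (ln x - ln y) <= x - y.
  by rewrite mulrC -ler_pdivlMr//; exact: ln_sub_le.
have H3 : 0 <= y * (ln x - ln y) by rewrite mulr_ge0// ltW.
set L := ln x - ln y in H1 H2 H3 *.
have -> : ln x + ln x - (ln y + ln y) = L + L by rewrite /L; lra.
have -> : x ^+ 2 * y ^+ 2 * (L + L) ^+ 2 = 4 * (x * (y * L)) ^+ 2 by ring.
have -> : x ^+ 2 - y ^+ 2 = (x - y) * (x + y) by ring.
rewrite ler_wpM2l// lerXn2r ?nnegrE//.
- by rewrite mulr_ge0// ltW.
- by apply: mulr_ge0; lra.
- rewrite mulrC ler_pM// ?(ltW x0)//.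
  by rewrite lerDl ltW//.
Qed.

(** The difference of the two sides is $(bf-ag)^2/(ab)$. This is the discrete form of testing with
    $f^2/h$. *)
Lemma caccioppoli_pair a b f g : 0 < a -> 0 < b ->
  (a - b) * (f ^+ 2 / a - g ^+ 2 / b) <= (f - g) ^+ 2.
Proof.
move=> a0 b0; rewrite -subr_ge0.
have -> : (f - g) ^+ 2 - (a - b) * (f ^+ 2 / a - g ^+ 2 / b) =
    (b * f - a * g) ^+ 2 / (a * b) by field; rewrite !gt_eqF.
by rewrite divr_ge0 ?sqr_ge0// ltW// mulr_gt0.
Qed.

(** Places the test function $f^2/h$ in the energy domain when $h\ge e$. The constant may blow up as
    $e\to0$, since only membership is drawn from it. *)
Lemma quotient_lipschitz a b e f g : 0 < e -> e <= a -> e <= b ->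
  0 <= f <= 1 -> 0 <= g <= 1 ->
  (f ^+ 2 / a - g ^+ 2 / b) ^+ 2 <=
    (8 / e ^+ 2 + 2 / e ^+ 4) * ((f - g) ^+ 2 + (a - b) ^+ 2).
Proof.
move=> e0 ea eb /andP[f0 f1] /andP[g0 g1].
have a0 : 0 < a by apply: lt_le_trans ea.
have b0 : 0 < b by apply: lt_le_trans eb.
(* One factor is varied at a time; the coefficients of $f-g$ and $b-a$ are at most $2/e$ and
   $1/e^2$. *)
have -> : f ^+ 2 / a - g ^+ 2 / b =
    (f - g) * ((f + g) / a) + (b - a) * (g ^+ 2 / (a * b)).
  by field; rewrite !gt_eqF.
have H1 : ((f + g) / a) ^+ 2 <= 4 / e ^+ 2.
  have -> : 4 / e ^+ 2 = (2 / e) ^+ 2 by field; rewrite gt_eqF.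
  rewrite lerXn2r ?nnegrE ?divr_ge0 ?addr_ge0 ?(ltW a0) ?(ltW e0)//.
  by rewrite ler_pM ?addr_ge0 ?invr_ge0 ?(ltW a0)// ?lef_pV2 ?posrE//; lra.
have H2 : (g ^+ 2 / (a * b)) ^+ 2 <= 1 / e ^+ 4.
  have -> : 1 / e ^+ 4 = (1 / (e * e)) ^+ 2 by field; rewrite gt_eqF.
  rewrite lerXn2r ?nnegrE ?divr_ge0 ?sqr_ge0 ?mulr_ge0 ?(ltW a0) ?(ltW b0) ?(ltW e0)//.
  rewrite ler_pM ?sqr_ge0 ?invr_ge0 ?mulr_ge0 ?(ltW a0) ?(ltW b0)//.
    by rewrite expr_le1.
  by rewrite lef_pV2 ?posrE ?mulr_gt0// ler_pM ?(ltW e0).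
set s := (f + g) / a in H1 *; set t := g ^+ 2 / (a * b) in H2 *.
set X := f - g; have -> : b - a = - (a - b) by ring.
set Y := a - b.
have H3 : (X * s + - Y * t) ^+ 2 <= 2 * (X ^+ 2 * s ^+ 2 + Y ^+ 2 * t ^+ 2).
  rewrite -subr_ge0.
  have -> : 2 * (X ^+ 2 * s ^+ 2 + Y ^+ 2 * t ^+ 2) - (X * s + - Y * t) ^+ 2 =
    (X * s + Y * t) ^+ 2 by ring.
  exact: sqr_ge0.
apply: le_trans H3 _.
have X2 := sqr_ge0 X; have Y2 := sqr_ge0 Y.
have e2 : 0 <= e ^- 2 by rewrite invr_ge0 exprn_ge0// ltW.
have e4 : 0 <= e ^- 4 by rewrite invr_ge0 exprn_ge0// ltW.
have H4 : X ^+ 2 * s ^+ 2 <= X ^+ 2 * (4 / e ^+ 2) by rewrite ler_wpM2l.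
have H5 : Y ^+ 2 * t ^+ 2 <= Y ^+ 2 * (1 / e ^+ 4) by rewrite ler_wpM2l.
have H6 := mulr_ge0 X2 e4; have H7 := mulr_ge0 Y2 e2.
apply: (@le_trans _ _ (2 * (X ^+ 2 * (4 / e ^+ 2) + Y ^+ 2 * (1 / e ^+ 4)))).
  by rewrite ler_wpM2l// lerD.
rewrite mulrDl !mulrDr; nra.
Qed.

(** Truncation $t\mapsto(t-e)^+$ is non-decreasing and 1-Lipschitz. *)
Lemma max_sub_pair a b e :
  (Num.max (a - e) 0 - Num.max (b - e) 0) ^+ 2 <=
    (a - b) * (Num.max (a - e) 0 - Num.max (b - e) 0) /\
  (Num.max (a - e) 0 - Num.max (b - e) 0) ^+ 2 <= (a - b) ^+ 2.
Proof.
have [ha|ha] := leP (a - e) 0; have [hb|hb] := leP (b - e) 0.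
- by rewrite subrr mulr0 expr0n sqr_ge0.
- have st : 0 <= (e - a) * (b - e) by apply: mulr_ge0; lra.
  by have := sqr_ge0 (e - a); split; nra.
- have st : 0 <= (e - b) * (a - e) by apply: mulr_ge0; lra.
  by have := sqr_ge0 (e - b); split; nra.
- by split; nra.
Qed.

End RealInequalities.

(** * Continuous functions and their supports *)

Section ContinuousFunctions.
Context {R : realType} (T : topologicalType).

(** Support inside [G], with an explicit closed set [F] as witness, in the form in which
    [same_cell_small] uses it. *)
Definition vanishes_off (G : set T) (v : T -> R) : Prop :=
  exists F : set T, [/\ closed F, F `<=` G & forall x, ~ F x -> v x = 0].

Lemma glue_continuous (F G : set (T)) (g v : T -> R) :
  closed F -> open G -> F `<=` G -> (forall x, ~ F x -> v x = 0) ->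
  (forall x, G x -> v x = g x) -> (forall x, G x -> {for x, continuous g}) ->
  continuous v.
Proof.
move=> cF oG FG v0 vg cg x A; have [Fx|nFx] := pselect (F x).
  have Gx := FG _ Fx; rewrite (vg _ Gx) => /(cg _ Gx) gA.
  have := oG; rewrite openE => /(_ _ Gx) nG.
  apply: (@filterS _ (nbhs x) _ _ _ _ (filterI nG gA)) => y [Gy].
  by rewrite /= vg.
move=> /nbhs_singleton; rewrite v0// => A0.
have := closed_openC cF; rewrite openE => /(_ _ nFx).
by apply: (@filterS _ (nbhs x)) => y Fy; rewrite /= v0.
Qed.

Lemma closed_ge (u : T -> R) (e : R) :
  continuous u -> closed [set x | e <= u x].
Proof.
by move=> cu; apply: (@preimage_closed _ _ u [set t | e <= t]) => // x _; exact: cu.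
Qed.

Lemma open_gt (u : T -> R) (e : R) :
  continuous u -> open [set x | e < u x].
Proof.
by move=> cu; apply: (@open_comp _ _ u [set t | e < t]) => // x _; exact: cu.
Qed.

Lemma continuous_subc (u : T -> R) (e : R) :
  continuous u -> continuous (fun x => u x - e).
Proof. by move=> cu x; apply: cvgB; [exact: cu|exact: cvg_cst]. Qed.

Lemma continuous_csub (u : T -> R) (e : R) :
  continuous u -> continuous (fun x => e - u x).
Proof. by move=> cu x; apply: cvgB; [exact: cvg_cst|exact: cu]. Qed.

Lemma continuous_maxc (u : T -> R) (e : R) :
  continuous u -> continuous (fun x => Num.max (u x) e).
Proof.
by move=> cu x; apply: (@continuous_max R T u (fun=> e)); [exact: cu|exact: cvg_cst].
Qed.

Lemma continuous_sqr_div (f h : T -> R) (x : T) : continuous f -> continuous h ->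
  h x != 0 -> {for x, continuous (fun y => f y ^+ 2 / h y)}.
Proof.
move=> cf ch hx; apply: cvgM; first by apply: cvgM; exact: cf.
by apply: cvgV => //; exact: ch.
Qed.

End ContinuousFunctions.

(** * Weak and strong maximum principles for subharmonic functions on $K$ *)

Section MaximumPrinciple.
Context {R : realType} (S : self_similar R).
Context (c : fractal S -> fractal S -> R) (r : 'I_(nmaps S) -> R).
Context (Spcf : post_critically_finite S) (Hharm : regular_harmonic_structure c r).
Context (Hres : resistance_form (domE c r) (energy c r)).

Local Notation dom := (domE c r).
Local Notation En := (En c r).
Local Notation energy := (energy c r).

(** Weak form of $\Delta u\ge0$ on [G]; the sign is that of $\mathcal{E}(u,v)=-\int v\,d(\Delta
    u)$. *)
Definition subharmonic (G : set (fractal S)) (u : fractal S -> R) : Prop :=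
  forall v, dom v -> (forall x, 0 <= v x) -> vanishes_off G v ->
    energy u v <= 0.

(* The test function (u - e)^+ 1_G, with M < e, vanishes near the boundary of G, so
   that at a fine scale no cell sees both its support and the complement of G. *)
Lemma weak_maximum (G : set (fractal S)) (u : fractal S -> R) (M : R) :
  open G -> dom u -> subharmonic (G `&` [set x | 0 < u x]) u -> 0 <= M ->
  (forall x, closure G x -> ~ G x -> u x <= M) -> (exists b, ~ G b) ->
  forall x, G x -> u x <= M.
Proof.
move=> oG du sub M0 bM [b nGb] x Gx; rewrite leNgt; apply/negP => Mx.
pose e := (M + u x) / 2.
have eM : M < e by rewrite /e; lra.
have ex : e < u x by rewrite /e; lra.
have [cu _] := du.
pose F := G `&` [set y | e <= u y].
have FG : F `<=` G by move=> y [].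
have cF : closed F.
  (* A limit point of [F] outside [G] would be a boundary point of [G], where $u\le M<e$. *)
  have -> : F = closure G `&` [set y | e <= u y].
    apply/seteqP; split => [y [Gy uy]|y [Gy uy]]; split => //.
      exact: subset_closure.
    apply: contrapT => nGy; have := bM _ Gy nGy.
    by rewrite leNgt (lt_le_trans eM).
  by apply: closedI; [exact: closed_closure|exact: closed_ge].
pose g y : R := Num.max (u y - e) 0.
pose v y : R := if `[< G y >] then g y else 0.
have vg y : G y -> v y = g y by move=> Gy; rewrite /v asboolT.
have v0 y : ~ F y -> v y = 0.
  rewrite /v; case: asboolP => // Gy nF; rewrite /g max_r//.
  by rewrite subr_le0 leNgt; apply/negP => /ltW uy; apply: nF.
have cg : continuous g by apply/continuous_maxc/continuous_subc.
have cv : continuous v.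
  by apply: (@glue_continuous R _ F G g) => // y _; exact: cg.
have dv : dom v.
  apply: (domE_local Spcf Hharm cF oG FG du du (ler01 : 0 <= 1 :> R)) => // y z Gy Gz.
  rewrite mul1r !vg//; have [_] := max_sub_pair (u y) (u z) e.
  by move=> /le_trans; apply; rewrite lerDl sqr_ge0.
have v_ge0 y : 0 <= v y by rewrite /v; case: asboolP; rewrite // le_max lexx orbT.
have uv : energy u v <= 0.
  apply: sub => //; exists F; split => // y [Gy uy]; split => //=.
  by apply: lt_le_trans uy; exact: le_lt_trans eM.
have vv : energy v v <= 0.
  apply: le_trans uv; apply: (le_energy Spcf Hharm Hres) => //.
  have := same_cell_small cF oG FG; apply: filterS => n Hn y z /Hn.
  rewrite /dkernel => -[[Gy Gz]|[Fy Fz]]; last by rewrite !v0// subrr mulr0 mulr0.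
  by rewrite !vg//; have [+ _] := max_sub_pair (u y) (u z) e; rewrite expr2.
have [a va] : exists a, v = fun=> a.
  by apply/(rf_eq0 Hres dv)/eqP; rewrite eq_le vv (rf_ge0 Hres).
(* The constant is zero because of [b] outside [G], yet [v] is positive at [x]. *)
have : v x = v b by rewrite va.
rewrite vg// (v0 b); last by case.
by rewrite /g max_l ?subr_ge0 ?ltW// => /eqP; rewrite subr_eq0 gt_eqF.
Qed.

(** A resistance form separates points. Finitely many functions vanishing at [x] cover the
    complement of [G], and their clamped sum [f] is 0 at [x] and at least 1 off [G]. *)
Lemma cutoff (G : set (fractal S)) (x : fractal S) : open G -> G x ->
  exists f, [/\ dom f, forall y, 0 <= f y <= 1, vanishes_off G f &
    nbhs x [set y | f y = 1]].
Proof.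
move=> oG Gx.
pose clamp (f : fractal S -> R) y := Num.min (Num.max (f y) 0) 1.
have dclamp f : dom f -> dom (clamp f) by move=> /(rf_markov Hres)[].
have clamp01 f y : 0 <= clamp f y <= 1.
  by rewrite /clamp le_min ge_min le_max !lexx ler01 !orbT.
have /choice[g Hg] (y : fractal S) : exists g : fractal S -> R,
    ~ G y -> [/\ dom g, g x = 0 & g y = 2].
  have [Gy|nGy] := pselect (G y); first by exists (fun=> 0).
  have [|g dg gE] := rf_extend Hres (V := [set x; y])
    (fun z => if z == x then 0 else 2); first by rewrite finite_setU.
  exists g => _; split => //; first by rewrite gE ?eqxx//; left.
  rewrite gE; last by right.
  by case: eqP => // yx; case: nGy; rewrite yx.
have dg y : ~ G y -> dom (clamp (g y)) by move=> /Hg[/dclamp].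
have : cover_compact (~` G).
  by rewrite -compact_cover; apply: closed_fractal_compact; exact: open_closedC.
move=> /(_ _ (~` G) (fun y => [set z | 1 < g y z])) [].
- by move=> y /Hg[[cg _] _ _]; exact: open_gt.
- by move=> y nGy; exists y => //=; have [_ _ ->] := Hg _ nGy; rewrite ltr1n.
move=> D DG Dcov.
pose f z := \sum_(y <- D) clamp (g y) z.
have df : dom f.
  have : {in (D : seq _), forall y, ~ G y} by move=> y /DG /set_mem.
  rewrite /f; elim: (D : seq _) => [|y s IH] Hs.
    suff -> : (fun z => \sum_(y <- [::]) clamp (g y) z) = (fun=> 0 : R).
      exact: rf_const Hres 0.
    by apply/funext => z; rewrite big_nil.
  suff -> : (fun z => \sum_(t <- y :: s) clamp (g t) z) =
      (fun z => 1 * clamp (g y) z + \sum_(t <- s) clamp (g t) z).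
    apply: (rf_linear Hres); first by apply: dg; apply: Hs; rewrite mem_head.
    by apply: IH => t ts; apply: Hs; rewrite inE ts orbT.
  by apply/funext => z; rewrite big_cons mul1r.
have fx : f x = 0.
  rewrite /f big_seq big1// => y /DG /set_mem nGy.
  by rewrite /clamp; have [_ -> _] := Hg _ nGy; rewrite maxxx min_l.
have f1 z : ~ G z -> 1 <= f z.
  move=> /Dcov[y /= yD gyz]; rewrite /f (big_fsetD1 y)//= -[leLHS]addr0 lerD//.
    by rewrite /clamp max_l ?min_r// ltW// (lt_trans ltr01).
  by apply: sumr_ge0 => t _; have /andP[] := clamp01 (g t) z.
have cf : continuous f by have [] := df.
(* The affine map sends $f\le1/3$ to values at least 1 and $f\ge2/3$ to values at most 0, leaving
   room on both sides. *)
pose h := clamp (fun z => -3 * f z + 2).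
have dh : dom h.
  by apply: dclamp; apply: (rf_linear Hres) => //; exact: rf_const Hres 2.
exists h; split => //; first exact: clamp01.
  exists [set z | - (2 / 3) <= 0 - f z]; split.
  - exact: (@closed_ge R _ (fun z => 0 - f z)) (continuous_csub cf).
  - move=> z /= fz; apply: contrapT => /f1; lra.
  - move=> z /= /negP; rewrite -ltNge => fz.
    by rewrite /h /clamp max_r ?min_l//; lra.
have : nbhs x [set z | - (1 / 3) < 0 - f z].
  apply: open_nbhs_nbhs; split; last by rewrite /= fx; lra.
  exact: (@open_gt R _ (fun z => 0 - f z)) (continuous_csub cf).
apply: (@filterS _ (nbhs x)) => z /= fz.
by rewrite /h /clamp max_l ?min_r//; lra.
Qed.

(* Testing with f^2 / h, where h = M - u + e, bounds the energy of ln h on the cell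
   uniformly in e, hence also the oscillation of ln h; let e go to 0. *)
Lemma harnack_cell (G : set (fractal S)) (u f : fractal S -> R) (w : seq 'I_(nmaps S))
    (M : R) (a b : fractal S) :
  open G -> dom u -> subharmonic G u -> (forall x, G x -> u x <= M) ->
  dom f -> (forall y, 0 <= f y <= 1) -> vanishes_off G f ->
  (forall z, f (Fword w z) = 1) -> u (Fword w a) = M -> u (Fword w b) = M.
Proof.
move=> oG du sub uM df f01 [F [cF FG f0]] fw ua.
have [cu _] := du; have [cf _] := df.
have wG z : G (Fword w z).
  apply: FG; apply: contrapT => /f0; rewrite fw => /eqP; by rewrite oner_eq0.
have [T HT] := rf_metric Hres a b.
(* The 4 is that of [ln_sub_sqr], [rword r w] rescales the cell to $K$, and the summand 1 leaves
   room in the limit of $E_n(f,f)+E_n(u,v)$. None of them depends on [e]. *)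
pose B := 4 * (rword r w * (energy f f + 1)).
have rw0 := rword_gt0 Hharm w.
have B0 : 0 <= B.
  by rewrite !mulr_ge0 ?(ltW rw0)// addr_ge0// (rf_ge0 Hres).
have main e : 0 < e -> (ln (M - u (Fword w b) + e) - ln e) ^+ 2 <= `|T| * B.
  move=> e0.
  pose h z := M - u z + e.
  have he z : G z -> e <= h z by move=> /uM; rewrite /h; lra.
  have h0 z : G z -> 0 < h z by move=> /he; apply: lt_le_trans.
  have ch : continuous h.
    have -> : h = fun z => M + e - u z by apply/funext => z; rewrite /h; ring.
    exact: continuous_csub.
  pose v z := if `[< G z >] then f z ^+ 2 / h z else 0.
  have vG z : G z -> v z = f z ^+ 2 / h z by move=> Gz; rewrite /v asboolT.
  have v0 z : ~ F z -> v z = 0.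
    by move=> /f0 fz; rewrite /v; case: ifP => // _; rewrite fz expr0n mul0r.
  have cv : continuous v.
    apply: (@glue_continuous R _ F G (fun z => f z ^+ 2 / h z)) => // z Gz.
    by apply: continuous_sqr_div => //; rewrite gt_eqF// h0.
  have dh : dom h.
    have -> : h = fun z => -1 * u z + (M + e) by apply/funext => z; rewrite /h; lra.
    by apply: (rf_linear Hres) => //; exact: (rf_const Hres).
  have dv : dom v.
    apply: (domE_local (C := 8 / e ^+ 2 + 2 / e ^+ 4) Spcf Hharm cF oG FG df dh) => //.
      by rewrite addr_ge0// divr_ge0// exprn_ge0// ltW.
    by move=> y z Gy Gz; rewrite !vG//; apply: quotient_lipschitz => //; exact: he.
  have uv : energy u v <= 0.
    apply: sub => //; last by exists F.
    move=> z; rewrite /v; case: asboolP => // Gz.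
    by rewrite divr_ge0 ?sqr_ge0// ltW// h0.
  pose l z := ln (h (Fword w z)).
  pose K y z := dkernel f f y z + dkernel u v y z.
  (* Non-negativity of the whole kernel, from [caccioppoli_pair], allows the sum to be restricted to
     the cell of [w]. *)
  have HK : \forall n \near \oo, forall y z, same_cell n y z -> 0 <= K y z.
    have := same_cell_small cF oG FG; apply: filterS => n Hn y z /Hn.
    rewrite /K /dkernel => -[[Gy Gz]|[Fy Fz]]; last first.
      by rewrite !v0// !f0// !subrr !mulr0 addr0.
    rewrite !vG//.
    have := caccioppoli_pair (f y) (f z) (h0 _ Gy) (h0 _ Gz).
    have -> : u y - u z = - (h y - h z) by rewrite /h; ring.
    by rewrite mulNr subr_ge0 expr2.
  (* On the cell [f] is 1, so the kernel becomes $(p-q)^2/(pq)$, which dominates the logarithmic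
     difference. *)
  have Kl y z : 4^-1 * dkernel l l y z <= K (Fword w y) (Fword w z).
    rewrite /K /dkernel !fw subrr mul0r add0r !vG// !fw expr1n.
    have hy := h0 _ (wG y); have hz := h0 _ (wG z).
    have -> : u (Fword w y) - u (Fword w z) = - (h (Fword w y) - h (Fword w z)).
      by rewrite /h; ring.
    have := ln_sub_sqr hy hz; rewrite /l.
    set p := h (Fword w y) in hy *; set q := h (Fword w z) in hz *.
    have -> : - (p - q) * (1 / p - 1 / q) = (p - q) ^+ 2 / (p * q).
      by field; rewrite !gt_eqF.
    rewrite ler_pdivlMr ?mulr_gt0// -expr2 => H.
    by rewrite mulrC mulrCA -ler_pdivlMl ?invr_gt0// invrK; move: H; rewrite mulrC.
  have El : \forall n \near \oo, En n l l <= B.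
    have cvK : (fun n => En n f f + En n u v) @ \oo --> energy f f + energy u v.
      by apply: cvgD; apply: (domE_cvg Spcf Hharm Hres).
    have : \forall n \near \oo, En n f f + En n u v < energy f f + 1.
      by apply: (cvgr_lt _ cvK); lra.
    move=> [n1 _ H1]; have [n2 _ H2] := HK.
    exists (maxn n1 n2) => // n; rewrite /= geq_max => /andP[n1n n2n].
    have n1w : (n1 <= size w + n)%N by rewrite (leq_trans n1n)// leq_addl.
    have n2w : (n2 <= size w + n)%N by rewrite (leq_trans n2n)// leq_addl.
    have := kform_cell Spcf Hharm (H2 _ n2w).
    have -> : kform c r (size w + n) K = En (size w + n) f f + En (size w + n) u v.
      by rewrite /K kformD -!En_kform.
    move=> /le_trans/(_ (ltW (H1 _ n1w))).
    rewrite ler_pdivrMl// => H.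
    rewrite /B -ler_pdivrMl//; apply: le_trans H.
    rewrite En_kform// -kformZ; exact: le_kform.
  have dl : dom l.
    apply: (domE_bounded Spcf Hharm (B := B)) => // z.
    apply: (@continuous_comp _ _ _ (h \o Fword w) (@ln R)).
      exact: continuous_comp (@Fword_continuous _ _ w z) (ch _).
    exact: continuous_ln (h0 _ (wG z)).
  have lB : energy l l <= B.
    by apply: limr_le => //; have [] := dl.
  have -> : ln (M - u (Fword w b) + e) - ln e = l b - l a.
    by rewrite /l /h ua subrr add0r.
  (* The resistance bound divides by the energy; when the energy is zero, [l] is constant. *)
  have [l0|l0] := ltP 0 (energy l l).
    have := HT _ dl l0; rewrite ler_pdivrMr// distrC real_normK ?num_real// => HTl.
    apply: le_trans HTl _; apply: (@le_trans _ _ (`|T| * energy l l)).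
      by rewrite ler_pM2r// ler_norm.
    by rewrite ler_wpM2l.
  have [k lk] : exists k, l = fun=> k.
    by apply/(rf_eq0 Hres dl)/eqP; rewrite eq_le l0 (rf_ge0 Hres).
  by rewrite lk subrr expr0n /= mulr_ge0.
have TB0 : 0 <= `|T| * B by rewrite mulr_ge0.
set Q := `|T| * B in main TB0.
apply/eqP; rewrite eq_le uM//= leNgt; apply/negP => ub.
pose d := M - u (Fword w b).
have d0 : 0 < d by rewrite subr_gt0.
(* With this choice $\ln(d+e)-\ln e\ge Q+1$, whose square exceeds the bound [Q]. *)
pose e := d * expR (- (Q + 1)).
have e0 : 0 < e by rewrite mulr_gt0// expR_gt0.
have := main e e0; rewrite -/d leNgt => /negP; apply.
have Hd : ln d <= ln (d + e).
  have de : d <= d + e by rewrite lerDl ltW.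
  by rewrite ler_ln ?posrE// addr_gt0.
have He : ln e = ln d - (Q + 1) by rewrite /e lnM ?posrE ?expR_gt0// expRK.
have HQ : Q + 1 <= ln (d + e) - ln e by rewrite He; lra.
have Q1 : 0 <= Q + 1 by lra.
apply: (@lt_le_trans _ _ ((Q + 1) ^+ 2)); first by nra.
by rewrite lerXn2r ?nnegrE// (le_trans Q1).
Qed.

(** Sufficiently small cells containing [x] lie where a cutoff equals 1, and together they form a
    neighbourhood of [x]; [harnack_cell] spreads the maximum over each of them. *)
Lemma strong_maximum (G : set (fractal S)) (u : fractal S -> R) (x : fractal S) :
  open G -> dom u -> subharmonic (G `&` [set x | 0 < u x]) u ->
  G x -> 0 < u x -> (forall y, G y -> u y <= u x) ->
  nbhs x [set y | u y = u x].
Proof.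
move=> oG du sub Gx ux uM; have [cu _] := du.
have oP : open (G `&` [set x | 0 < u x]) by apply: openI => //; exact: open_gt.
have [f [df f01 fP nf]] := cutoff oP (conj Gx ux : (G `&` [set x | 0 < u x]) x).
have cx : closed [set x].
  by apply: accessible_closed_set1; apply/hausdorff_accessible/fractal_hausdorff.
have [n Hn] : exists n, forall w, size w = n -> cell w x ->
    cell w `<=` [set y | f y = 1].
  have [n0 Hn0] := small_cells (F := [set x]) cx (@open_interior _ [set y | f y = 1])
    (fun y yx => eq_ind_r (fun y => _^° y) nf yx).
  exists n0 => w sw wx y wy; apply: interior_subset.
  by apply: (Hn0 n0 w) => //; exists x.
(* There are finitely many words of length [n], and a cell missing [x] is closed, so it also misses
   a neighbourhood of [x]. *)
have : nbhs x [set y | forall w : n.-tuple 'I_(nmaps S), cell w y -> cell w x].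
  apply: (@filter_forall _ _ _ (nbhs x) (nbhs_filter x)) => w.
  have [wx|nwx] := pselect (cell w x); first by apply: (@filterE _ (nbhs x)).
  have cw : closed (cell w).
    apply: (@closed_image_fractal _ _ (Fword w) setT); last exact: closedT.
    exact: Fword_continuous.
  have := closed_openC cw; rewrite openE => /(_ _ nwx).
  by apply: (@filterS _ (nbhs x)) => y nwy /nwy.
apply: (@filterS _ (nbhs x)) => y Hy /=.
have [w sw wy] := cell_cover n y.
have /eqP sw' := sw.
have wx := Hy (Tuple sw') wy.
have w1 := Hn _ sw wx.
move: wx wy => [a _ ax] [b _ bY]; rewrite -bY.
apply: (@harnack_cell _ u f w (u x) a b oP du sub) => //.
- by move=> z [/uM].
- by move=> z; apply: w1; exists z.
- by rewrite ax.
Qed.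

End MaximumPrinciple.

(** * The infinite blow-up *)

Section BlowupTopology.
Context {R : realType} (S : self_similar R) (alpha : nat -> 'I_(nmaps S)).

Local Notation phi := (@phi R S alpha).
Local Notation push := (push alpha).

Lemma phi_push n k x : phi (n + k) (push n k x) = phi n x.
Proof. by elim: k => [|k IH] /=; rewrite ?addn0// addnS phi_step. Qed.

Lemma push_continuous n k : continuous (push n k).
Proof.
elim: k => [|k IH] x; first exact: cvg_id.
exact: continuous_comp (IH x) (@Fmap_continuous _ _ _ _).
Qed.

Lemma phi_continuous n : continuous (phi n).
Proof. by apply/continuousP => U /blowup_openP. Qed.

Lemma blowup_closedP (A : set (blowup alpha)) :
  closed A <-> forall n, closed (phi n @^-1` A).
Proof.
rewrite -openC blowup_openP; split => H n; have := H n.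
  by rewrite preimage_setC openC.
by rewrite -openC preimage_setC.
Qed.

Lemma blowup_continuous (T : topologicalType) (f : blowup alpha -> T) :
  (forall n, continuous (f \o phi n)) -> continuous f.
Proof.
move=> cf; apply/continuousP => U oU; apply/blowup_openP => n.
by have /continuousP := cf n; exact.
Qed.

(** The trace on $K_k$ is a preimage under [push] for smaller $k$ and an image under [push] for
    larger $k$; the image is closed by compactness. *)
Lemma closed_phi n (A : set (fractal S)) : closed A -> closed (phi n @` A).
Proof.
move=> cA; apply/blowup_closedP => k; have [kn|/ltnW nk] := leqP k n.
  have -> : phi k @^-1` (phi n @` A) = push k (n - k) @^-1` A.
    apply/seteqP; split => y /=.
      by move=> [x Ax]; rewrite -(phi_push k (n - k) y) subnKC// => /phi_inj <-.
    by move=> Ay; exists (push k (n - k) y) => //; rewrite -[in phi n](subnKC kn) phi_push.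
  by have /continuous_closedP := @push_continuous k (n - k); exact.
have -> : phi k @^-1` (phi n @` A) = push n (k - n) @` A.
  apply/seteqP; split => y /=.
    move=> [x Ax]; rewrite -(phi_push n (k - n) x) subnKC// => /phi_inj <-.
    by exists x.
  by move=> [x Ax <-]; exists x => //; rewrite -(phi_push n (k - n) x) subnKC.
exact: closed_image_fractal (@push_continuous _ _) cA.
Qed.

Lemma range_phi_le m k : (m <= k)%N -> range (phi m) `<=` range (phi k).
Proof.
move=> mk _ [x _ <-]; exists (push m (k - m) x) => //.
by rewrite -(phi_push m (k - m)) subnKC.
Qed.

Lemma range_phi_not_sub k : ~ (range (phi k.+1) `<=` range (phi k)).
Proof.
move=> H; have [x nx] := Fmap_not_surj (alpha k); apply: nx.
have [y _ yx] := H _ (imageT (phi k.+1) x).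
by exists y => //; apply: (@phi_inj _ _ alpha k.+1); rewrite phi_step.
Qed.

Lemma compact_bounded_closed (A : set (blowup alpha)) m :
  closed A -> A `<=` range (phi m) -> compact A.
Proof.
move=> cA; apply: subclosed_compact => //.
apply: continuous_compact; last exact: fractal_compact.
exact/continuous_subspaceT/phi_continuous.
Qed.

(* A copy of a cell outside K_k meets K_k in finitely many points only, hence
   misses every open subset of K_k. *)
Lemma vanishes_on_new_cell (Spcf : post_critically_finite S)
    (v : blowup alpha -> R) (k : nat) (i : 'I_(nmaps S)) (x : fractal S) :
  continuous v -> (forall z, v z != 0 -> range (phi k) z) -> i != alpha k ->
  v (phi k.+1 (Fmap i x)) = 0.
Proof.
move=> cv vk ik; have [V0fin Vcell] := Spcf.
pose U := [set y | v (phi k.+1 (Fmap i y)) != 0].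
have oU : open U.
  have cU : continuous (fun y => v (phi k.+1 (Fmap i y))).
    move=> y; apply: (@continuous_comp _ _ _ (phi k.+1 \o Fmap i) v); last exact: cv.
    apply: continuous_comp; first exact: Fmap_continuous.
    exact: phi_continuous.
  apply: (@open_comp _ _ _ [set t | t != 0]) => [y _|]; first exact: cU.
  exact: open_neq.
(* Where [v] is non-zero the point lies in two distinct cells of level one, so post-critical
   finiteness puts it in the image of [V0]. *)
have UV : U `<=` @V0 R S.
  move=> y /vk[z _ zy].
  have /phi_inj e : phi k.+1 (Fmap (alpha k) z) = phi k.+1 (Fmap i y).
    by rewrite phi_step.
  have [|//|_ [p Vp] /= /Fmap_inj <-//] :=
    Vcell [:: alpha k] [:: i] erefl _ (Fmap i y).
    by apply: contra_neq ik => -[].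
  by split; [exists z => //=; rewrite e|exists y].
have U0 := open_finite_set0 oU (sub_finite_set UV V0fin).
by apply/eqP/negPn/negP => vx; suff : U x by rewrite U0.
Qed.

End BlowupTopology.

(** * Extension by zero from one copy of $K$ *)

Section ExtensionByZero.
Context {R : realType} (S : self_similar R) (alpha : nat -> 'I_(nmaps S)).
Context (m : nat).

Local Notation phi := (@phi R S alpha).

Definition extend0 (v : fractal S -> R) (z : blowup alpha) : R :=
  if pselect (exists x, phi m x = z) is left h then v (sval (cid h)) else 0.

Lemma extend0_phi v x : extend0 v (phi m x) = v x.
Proof.
rewrite /extend0; case: pselect => [h|[]]; last by exists x.
by congr v; apply: (@phi_inj _ _ alpha m); exact: svalP (cid h).
Qed.

Lemma extend0_neq0 v z : extend0 v z != 0 -> range (phi m) z.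
Proof.
by rewrite /extend0; case: pselect => [[x xz] _|_]; [exists x|rewrite eqxx].
Qed.

Lemma extend0_continuous (E : set (blowup alpha)) (v : fractal S -> R) :
  open E -> E `<=` range (phi m) -> continuous v ->
  vanishes_off (phi m @^-1` E) v -> continuous (extend0 v).
Proof.
move=> oE Em cv [F [cF FE v0]]; apply/continuous_closedP => C cC.
have cvC : closed (phi m @` (v @^-1` C)).
  by apply: closed_phi; by move/continuous_closedP: cv; exact.
(* If [C] contains 0, its preimage also contains everything outside the open set [E]; otherwise it
   stays inside $K_m$. *)
have [C0|nC0] := pselect (C 0).
  suff -> : extend0 v @^-1` C = (phi m @` (v @^-1` C)) `|` ~` E.
    by apply: closedU => //; exact: open_closedC.
  apply/seteqP; split => z /=.
    move=> Cz; have [Ez|] := pselect (E z); last by right.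
    by have [x _ xz] := Em _ Ez; left; exists x => //=; rewrite -extend0_phi xz.
  move=> [[x Cx <-]|nEz]; first by rewrite extend0_phi.
  have [->//|] := eqVneq (extend0 v z) 0.
  move=> /[dup] /extend0_neq0 [x _ xz]; rewrite -xz extend0_phi.
  by move: nEz; rewrite -xz => nEx /eqP[]; apply: v0 => /FE.
suff -> : extend0 v @^-1` C = phi m @` (v @^-1` C) by [].
apply/seteqP; split => z /=.
  move=> Cz; have : extend0 v z != 0.
    by apply/eqP => z0; apply: nC0; rewrite -z0.
  by move=> /extend0_neq0[x _ xz]; exists x => //=; rewrite -extend0_phi xz.
by move=> [x Cx <-]; rewrite extend0_phi.
Qed.

Lemma compactly_supported_extend0 v : compactly_supported (extend0 v).
Proof.
apply: (@compact_bounded_closed _ _ _ _ m); first exact: closed_closure.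
have cK : closed (range (phi m)) by apply: closed_phi; exact: closedT.
rewrite [X in _ `<=` X](closure_id _).1//.
by apply: closureS => z; exact: extend0_neq0.
Qed.

End ExtensionByZero.

(** * Energy of functions extended by zero *)

Section BlowupForm.
Context {R : realType} (S : self_similar R) (alpha : nat -> 'I_(nmaps S)).
Context (c : fractal S -> fractal S -> R) (r : 'I_(nmaps S) -> R).
Context (Spcf : post_critically_finite S) (Hharm : regular_harmonic_structure c r).
Context (Hres : resistance_form (domE c r) (energy c r)).

Local Notation phi := (@phi R S alpha).
Local Notation dom := (domE c r).

Lemma domE_push n k v : dom v -> dom (v \o push alpha n k).
Proof.
elim: k v => [//|k IH] v dv.
by apply: (IH (v \o Fmap (alpha (n + k)))); exact: (domE_Fword Spcf Hharm [:: _] dv).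
Qed.

(** Words starting with [alpha k] reproduce the level [n] sum on $K_k$; on every other first-level
    cell of $K_{k+1}$ the function [v] vanishes. *)
Lemma En_new_stage (g v : blowup alpha -> R) k n :
  continuous v -> (forall z, v z != 0 -> range (phi k) z) ->
  En c r n.+1 (g \o phi k.+1) (v \o phi k.+1) =
  (r (alpha k))^-1 * En c r n (g \o phi k) (v \o phi k).
Proof.
move=> cv vk; rewrite !En_kform// kformS (bigD1 (alpha k))//= big1 ?addr0.
  by congr (_ * _); apply: eq_kform => // x y _; rewrite /dkernel /= !phi_step.
move=> i ik; rewrite -[X in _ * X](_ : 0 = _) ?mulr0//.
rewrite -(mul0r (kform c r n (fun _ _ => 0))) -kformZ.
apply: eq_kform => // x y _; rewrite /dkernel /= mulr0.
have v0 z : v (phi k.+1 (Fmap i z)) = 0 by exact: vanishes_on_new_cell.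
by rewrite !v0 subrr mulr0.
Qed.

Lemma domE_new_stage (v : blowup alpha -> R) k :
  continuous v -> (forall z, v z != 0 -> range (phi k) z) ->
  dom (v \o phi k) -> dom (v \o phi k.+1).
Proof.
move=> cv vk dv.
apply: (domE_bounded Spcf Hharm
    (B := (r (alpha k))^-1 * energy c r (v \o phi k) (v \o phi k))).
  move=> x; apply: continuous_comp; first exact: phi_continuous.
  exact: cv.
exists 1%N => // -[//|n] _ /=; rewrite En_new_stage//.
rewrite ler_pM2l ?invr_gt0 ?(r_gt0 Hharm)//.
exact: (En_le_energy Spcf Hharm n dv).
Qed.

(** The factor $r_{\alpha_{k+1}}^{-1}$ from the finer level cancels the new factor of the stage, so
    stage energies are eventually constant for functions supported in one copy. *)
Lemma energy_new_stage (g v : blowup alpha -> R) k :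
  continuous v -> (forall z, v z != 0 -> range (phi k) z) ->
  (forall n, dom (g \o phi n)) -> dom (v \o phi k) ->
  energy_stage c r g v k.+1 = energy_stage c r g v k.
Proof.
move=> cv vk dg dv.
have dv' := domE_new_stage cv vk dv.
have : energy c r (g \o phi k.+1) (v \o phi k.+1) =
    (r (alpha k))^-1 * energy c r (g \o phi k) (v \o phi k).
  have H1 := domE_cvg Spcf Hharm Hres (dg k.+1) dv'.
  have H2 := domE_cvg Spcf Hharm Hres (dg k) dv.
  (* Level [n.+1] on the new stage matches level [n] on the old one. *)
  rewrite -cvg_shiftS in H1.
  apply: (cvg_unique _ H1) => //.
  rewrite (_ : [sequence _]_n = fun n => (r (alpha k))^-1 *
      En c r n (g \o phi k) (v \o phi k)).
    by apply: cvgM => //; exact: cvg_cst.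
  by apply/funext => n; rewrite /= En_new_stage.
rewrite /energy_stage => ->; rewrite big_ord_recr /= -mulrA.
by rewrite [r _ * _]mulrA divff ?mul1r// gt_eqF ?(r_gt0 Hharm).
Qed.

Section Extension.
Context (m : nat) (E : set (blowup alpha)) (v : fractal S -> R).
Context (Eopen : open E) (Em : E `<=` range (phi m)).
Context (dv : dom v) (vE : vanishes_off (phi m @^-1` E) v).

Local Notation w := (@extend0 R S alpha m v).

Let cw : continuous w.
Proof. by apply: (extend0_continuous Eopen Em) vE; have [] := dv. Qed.

Let wk k z : (m <= k)%N -> w z != 0 -> range (phi k) z.
Proof. by move=> mk /extend0_neq0; exact: range_phi_le. Qed.

Lemma domE_extend0 n : dom (w \o phi n).
Proof.
have d0 : dom (w \o phi m).
  suff -> : w \o phi m = v by [].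
  by apply/funext => x; rewrite /= extend0_phi.
have [nm|/ltnW mn] := leqP n m.
  suff -> : w \o phi n = v \o push alpha n (m - n) by exact: domE_push.
  by apply/funext => x; rewrite /= -(phi_push alpha n (m - n)) subnKC// extend0_phi.
rewrite -(subnKC mn); elim: (n - m)%N => [|k IH]; first by rewrite addn0.
by rewrite addnS; apply: domE_new_stage => // z; apply: wk; exact: leq_addr.
Qed.

Lemma energy_stage_extend0 (g : blowup alpha -> R) k :
  (forall n, dom (g \o phi n)) -> (m <= k)%N ->
  energy_stage c r g w k = energy_stage c r g w m.
Proof.
move=> dg mk; rewrite -(subnKC mk); elim: (k - m)%N => [|j IH]; first by rewrite addn0.
rewrite addnS energy_new_stage//; last exact: domE_extend0.
by move=> z; apply: wk; exact: leq_addr.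
Qed.

Lemma domEinf_extend0 : domEinf c r w.
Proof.
split; first exact: domE_extend0.
apply: (is_cvg_near_cst (energy_stage c r w w m)).
by exists m => // k mk; apply: energy_stage_extend0 => //; exact: domE_extend0.
Qed.

Lemma energyinf_extend0 (g : blowup alpha -> R) : (forall n, dom (g \o phi n)) ->
  energyinf c r g w = (\prod_(k < m) r (alpha k)) * energy c r (g \o phi m) v.
Proof.
move=> dg; rewrite /energyinf (@lim_near_cst _ _ _ _ _ (energy_stage c r g w m))//.
  rewrite /energy_stage; congr (_ * energy c r _ _).
  by apply/funext => x; rewrite /= extend0_phi.
by exists m => // k mk; exact: energy_stage_extend0.
Qed.

End Extension.

End BlowupForm.

(** * Integrals against charges *)

Section ChargeIntegral.
Context d (T : measurableType d) (R : realType).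
Context (sigma : {charge set T -> \bar R}).

(** The negative Jordan part has no mass on [A], since the charge is non-negative on the part of [A]
    in the negative Hahn set. *)
Lemma charge_integral_ge0 (A : set T) (v : T -> R) :
  measurable A -> nonneg_on sigma A -> measurable_fun setT v ->
  (forall x, 0 <= v x) -> (forall x, ~ A x -> v x = 0) ->
  0 <= charge_integral sigma v.
Proof.
move=> mA sA mv v0 vA.
suff neg0 : \int[jordan_neg (hahnP sigma)]_x v x = 0.
  by rewrite /charge_integral neg0 subr0 Rintegral_ge0.
have [_ [mN negN] _ _] := hahnP sigma.
have nA : jordan_neg (hahnP sigma) A = 0%E.
  apply/eqP; rewrite eq_le measure_ge0 andbT.
  rewrite jordan_negE cjordan_negE /crestr0 mem_set// /crestr.
  by rewrite leeNl oppe0; apply: sA; [exact: measurableI|exact: subIsetl].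
rewrite /Rintegral (ge0_negligible_integral mA)//.
- rewrite integral0_eq// => x [_ nAx]; by rewrite vA.
- exact/measurable_EFinP.
- by move=> x _; rewrite lee_fin.
Qed.

End ChargeIntegral.

(** * The maximum principle on the blow-up *)

Lemma continuous_borel_measurable (R : realType) (T : ptopologicalType) (v : T -> R) :
  continuous v ->
  measurable_fun [set: g_sigma_algebraType (@open T)]
    (v : g_sigma_algebraType (@open T) -> R).
Proof.
move=> /continuousP cv; apply: (measurability _ (RGenOpens.measurableE R)).
move=> _ [_ [a [b ->] <-]]; rewrite setTI; apply: sub_sigma_algebra.
exact/cv/interval_open.
Qed.

(** * From the Laplacian on the blow-up to subharmonicity on one copy *)

Section Subharmonicity.
Context {R : realType} (S : self_similar R) (alpha : nat -> 'I_(nmaps S)).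

Local Notation phi := (phi alpha).

(** Where [u] is positive, $u\,\nu$ is non-negative, so $\Delta u\ge Lu\ge0$ there. *)
Lemma schroedinger_nonneg (sigma : {charge set (borel_blowup alpha) -> \bar R})
    (nu : {measure set (borel_blowup alpha) -> \bar R}) (u : blowup alpha -> R)
    (E : set (blowup alpha)) :
  nonneg_on (schroedinger sigma nu u) E ->
  nonneg_on sigma (E `&` [set z | 0 < u z]).
Proof.
move=> HL B mB BE.
have := HL B mB (subset_trans BE (@subIsetl _ _ _)).
rewrite /schroedinger; have I0 : (0 <= \int[nu]_(x in B) (u x)%:E)%E.
  by apply: integral_ge0 => x /BE[_ /= ux]; rewrite lee_fin ltW.
move=> H; apply: le_trans H _; rewrite -[leRHS]adde0; apply: leeD => //.
by rewrite oppe_le0.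
Qed.

Context (c : fractal S -> fractal S -> R) (r : 'I_(nmaps S) -> R).
Context (Spcf : post_critically_finite S) (Hharm : regular_harmonic_structure c r).
Context (Hres : resistance_form (domE c r) (energy c r)).

(** A test function on $K$ extends by zero to a compactly supported one on the blow-up, and its
    energy against [u] is a positive multiple of the energy on $K$. *)
Lemma laplacian_subharmonic (u : blowup alpha -> R)
    (sigma : {charge set (borel_blowup alpha) -> \bar R})
    (U : set (blowup alpha)) (m : nat) :
  is_laplacian c r u sigma -> open U -> U `<=` range (phi m) ->
  nonneg_on sigma U ->
  subharmonic c r (phi m @^-1` U) (u \o phi m).
Proof.
move=> [_ [du _] lap] oU Um sU v dv v0 vU.
have := lap _ (domEinf_extend0 Spcf Hharm Hres oU Um dv vU)
  (@compactly_supported_extend0 R S alpha m v).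
rewrite (energyinf_extend0 Spcf Hharm Hres oU Um dv vU du) => H.
have p0 : 0 < \prod_(k < m) r (alpha k).
  by apply: prodr_gt0 => k _; exact: r_gt0 Hharm _.
rewrite -(pmulr_rle0 _ p0) H oppr_le0.
have [F [_ FU vF]] := vU.
apply: (@charge_integral_ge0 _ (borel_blowup alpha) R sigma U
  (@extend0 R S alpha m v)) => //.
- exact: sub_sigma_algebra.
- apply: continuous_borel_measurable.
  by apply: (extend0_continuous oU Um) vU; have [] := dv.
- by move=> z; rewrite /extend0; case: pselect.
- move=> z nUz; apply/eqP/negPn/negP => /[dup] /extend0_neq0[x _ xz].
  by rewrite -xz extend0_phi vF ?eqxx// => /FU; rewrite /= xz.
Qed.

End Subharmonicity.

Theorem theorem2 (R : realType) (S : self_similar R)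
  (Spcf : post_critically_finite S)
  (c : fractal S -> fractal S -> R) (r : 'I_(nmaps S) -> R)
  (Hharm : regular_harmonic_structure c r)
  (Hres : resistance_form (domE c r) (energy c r))
  (alpha : nat -> 'I_(nmaps S)) (Halpha : ~ eventually_constant alpha)
  (nu : {measure set (borel_blowup alpha) -> \bar R}) (Hnu : radon nu)
  (E : set (blowup alpha)) (Eopen : open E) (Ebnd : blowup_bounded E)
  (u : blowup alpha -> R)
  (sigma : {charge set (borel_blowup alpha) -> \bar R})
  (Hu : is_laplacian c r u sigma)
  (HL : nonneg_on (schroedinger sigma nu u) E) :
  (E !=set0 ->
     exists p, [/\ boundary E p,
                   forall q, boundary E q -> u^\+ q <= u^\+ p &
                   forall x, E x -> u x <= u^\+ p]) /\
  (forall x, E x -> 0 < u x -> (forall y, E y -> u y <= u x) ->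
     forall y, connected_component E x y -> u y = u x).
Proof.
have [m Em] := Ebnd; have [_ [du _] _] := Hu.
have cu : continuous u by apply: blowup_continuous => n; have [] := du n.
have open_phi n (U : set (blowup alpha)) : open U -> open (phi alpha n @^-1` U).
  by move=> /blowup_openP; exact.
have oE := open_phi m E Eopen.
have sub : subharmonic c r
    (phi alpha m @^-1` E `&` [set x | 0 < (u \o phi alpha m) x]) (u \o phi alpha m).
  apply: (laplacian_subharmonic Spcf Hharm Hres (U := E `&` [set z | 0 < u z]) Hu).
  - by apply: openI => //; exact: open_gt.
  - by move=> z [/Em].
  - exact: schroedinger_nonneg HL.
split=> [[z0 Ez0]|x Ex ux uM y].
  have cK : closed (range (phi alpha m)) by apply: closed_phi; exact: closedT.
  have clE : closure E `<=` range (phi alpha m).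
    by rewrite [X in _ `<=` X](closure_id _).1//; exact: closureS.
  have bE z : boundary E z <-> closure E z /\ ~ E z.
    by rewrite /boundary ((interior_id _).1 Eopen).
  have bE0 : boundary E !=set0.
    (* Without boundary [E] would be clopen, hence contain all of the connected $K_{m+1}$, although
       it lies in the strictly smaller $K_m$. *)
    apply: contrapT => nb; apply: (@range_phi_not_sub R S alpha m).
    have cE : closed E.
      by move=> z cz; apply: contrapT => nEz; apply: nb; exists z; apply/bE.
    have ET : phi alpha m.+1 @^-1` E = setT.
      apply: (clopen_fractal Spcf Hharm Hres); first exact: open_phi.
        exact: ((blowup_closedP _).1 cE).
      have [x _ xz] := range_phi_le (leqnSn m) (Em _ Ez0).
      by exists x; rewrite /= xz.
    move=> _ [x _ <-]; apply: Em; suff : (phi alpha m.+1 @^-1` E) x by [].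
    by rewrite ET.
  have Kb : compact (boundary E).
    apply: (@compact_bounded_closed _ _ _ _ m); last by move=> z [/clE].
    by apply: closedI; [exact: closed_closure|apply: open_closedC; exact: open_interior].
  have cup : continuous u^\+ by exact: continuous_maxc.
  have [|p pb pmax] := compact_EVT_max bE0 Kb (f := u^\+).
    exact: continuous_subspaceT.
  exists p; split; first exact: set_mem.
    by move=> q bq; apply: pmax; exact: mem_set.
  move=> z Ez; have [x _ xz] := Em _ Ez; rewrite -xz.
  apply: (weak_maximum Spcf Hharm Hres oE (du m) sub).
  - exact: funrpos_ge0.
  - move=> y cy nEy; apply: (@le_trans _ _ (u^\+ (phi alpha m y))).
      by rewrite /funrpos le_max lexx.
    apply: pmax; apply: mem_set; apply/bE; split => // U nU.
    have [t [Et Ut]] := cy _ ((@phi_continuous _ _ alpha m) y _ nU).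
    by exists (phi alpha m t).
  - have [z' /bE[cz' nEz']] := bE0; have [b _ bz'] := clE _ cz'.
    by exists b; rewrite /= bz'.
  - by rewrite /= xz.
move=> [C [Cx CE Cconn] Cy].
pose A := E `&` [set z | u z = u x].
have oA : open A.
  pose A' := phi alpha m @^-1` A.
  have oA' : open A'.
    rewrite openE => a [Ea ua].
    have na : nbhs a (phi alpha m @^-1` E) by apply: open_nbhs_nbhs.
    have : nbhs a [set b | (u \o phi alpha m) b = (u \o phi alpha m) a].
      apply: (strong_maximum Spcf Hharm Hres oE (du m) sub) => //=.
        by rewrite ua.
      by move=> b Eb; rewrite ua; exact: uM.
    move=> /(filterI na); apply: (@filterS _ (nbhs a)) => b [Eb /= ub].
    by split => //=; rewrite ub.
  (* An open subset of $K_m$ need not be open in $K_\infty$; inside the open set [E] it is, as the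
     image of the complement of [A'] is closed. *)
  suff -> : A = E `&` ~` (phi alpha m @` (~` A')).
    by apply: openI => //; apply: closed_openC; apply: closed_phi; exact: open_closedC.
  apply/seteqP; split => z [Ez zA]; split => //.
    by move=> [b nb bz]; apply: nb; rewrite /A' /= bz.
  apply: contrapT => nz; apply: zA; have [b _ bz] := Em _ Ez.
  by exists b => // -[_ /=]; rewrite bz.
have cux : closed [set z | u z = u x].
  by apply: (@preimage_closed _ _ u [set u x]) => [z _|]; [exact: cu|exact: closed_eq].
(* The part of [C] where the maximum is attained is non-empty and both open and closed in the
   connected set [C]. *)
have CA : C `&` A = C.
  apply: Cconn; first by exists x.
  - by exists A.
  - exists [set z | u z = u x] => //.
    by apply/seteqP; split => [z [Cz [_ uz]]|z [Cz uz]]; split => //; split => //; exact: CE.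
by move: Cy; rewrite -CA => -[_ []].
Qed.
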